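(* Let $X$ be a Banach space. Then there is a cluster value theorem for $H_b(X)$; that is, for every $r>0$, every $f\in H_b(X)$ and every $z\in r\overline{B}_{X^{**}}$, $$Cl_r(f,z)=\hat f(\mathcal{M}_{z,r}).$$ Moreover, both sets are equal to the singleton $\{\tilde f(z)\}$.
   Context: All Banach spaces are complex. $B_X$ is the open unit ball of $X$, $\overline{B}_{X^{**}}$ the closed unit ball of the second dual $X^{**}$; $X$ is regarded as a subspace of $X^{**}$. $\mathcal{P}(X)$ is the space of continuous polynomials on $X$ (including constants). $H_b(X)$ is the Fréchet algebra of entire functions $X\to\mathbb{C}$ that are bounded on bounded subsets of $X$. $\mathcal{M}(H_b(X))$ is its spectrum, the set of non-zero continuous multiplicative linear functionals on $H_b(X)$, and $\hat f:\mathcal{M}(H_b(X))\to\mathbb{C}$, $\hat f(\varphi)=\varphi(f)$, is the Gelfand transform of $f\in H_b(X)$. Aron-Berner extension: if $P$ is a continuous $m$-homogeneous polynomial on $X$ with associated symmetric continuous $m$-linear form $A$, let $\tilde A(z_1,\dots,z_m)=\lim_{\alpha_1}\cdots\lim_{\alpha_m}A(x^1_{\alpha_1},\dots,x^m_{\alpha_m})$, where $(x^i_{\alpha_i})$ is a net in $X$ converging weak-star to $z_i\in X^{**}$, and $\tilde P(z)=\tilde A(z,\dots,z)$; extend linearly to $\mathcal{P}(X)$. For $f\in H_b(X)$ with Taylor series $f=\sum_m P_m$ at $0$, $\tilde f=\sum_m\tilde P_m$ on $X^{**}$. The polynomial-star topology on $X^{**}$ is the coarsest topology making all $\tilde P$,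 $P\in\mathcal{P}(X)$, continuous; convergence in it is written $\xrightarrow{\mathcal P}$. For $r>0$, $f\in H_b(X)$ and $z\in r\overline{B}_{X^{**}}$, the polynomial $r$-cluster set of $f$ at $z$ is $$Cl_r(f,z)=\{\lambda\in\mathbb{C}:\text{ there exists a net }(x_\alpha)\subset rB_X\text{ such that }x_\alpha\xrightarrow{\mathcal P}z,\ f(x_\alpha)\to\lambda\}.$$ For $z\in X^{**}$ and $r>0$, the polynomial $r$-fiber over $z$ is $$\mathcal{M}_{z,r}=\{\varphi\in\mathcal{M}(H_b(X)):\pi(\varphi)=z,\ \varphi\prec rB_X\},$$ where $\pi(\varphi)=\varphi|_{\mathcal{P}(X)}$, so that $\pi(\varphi)=z$ means $\varphi(P)=\tilde P(z)$ for all $P\in\mathcal{P}(X)$, and $\varphi\prec rB_X$ means $|\varphi(g)|\le\|g\|_{rB_X}:=\sup_{x\in rB_X}|g(x)|$ for every $g\in H_b(X)$. *)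

(* Defs.v *)
From HB Require Import structures.
From mathcomp Require Import all_boot all_order all_algebra all_fingroup.
From mathcomp Require Import all_classical all_reals all_analysis.
From mathcomp Require Import complex.

Set Implicit Arguments.
Unset Strict Implicit.
Unset Printing Implicit Defensive.

Import Order.TTheory GRing.Theory Num.Theory.
Import numFieldNormedType.Exports.

Local Open Scope classical_set_scope.
Local Open Scope ring_scope.
Local Open Scope complex_scope.

(* The complex numbers over R, as a normed space over themselves. *)
Notation Cplx R := (R[i]^o).

Section DualSpace.
Variables (R : realType) (X : normedModType R[i]).
Implicit Types (f g : X -> Cplx R).

Definition supnorm (T : Type) (A : set T) (f : T -> Cplx R) : R :=
  sup [set Normc.normc (f x) | x in A].

Definition dual_pred : {pred X -> Cplx R} :=
  fun f : X -> Cplx R => `[< linear f /\ continuous f >].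

Fact dual_submod_closed : subsemimod_closed dual_pred.
Proof.
apply: GRing.submod_closed_semi; split=> [|c f g].
  by apply/asboolP; split=> [a x y|x];
    [rewrite /= scaler0 addr0|exact: cst_continuous].
move=> /asboolP[lf cf] /asboolP[lg cg]; apply/asboolP; split=> [a x y|x].
  by rewrite !fctE lf lg !scalerDr !scalerA (mulrC c) addrACA.
by apply: (@cvgD _ (Cplx R) X); [apply: cvgZl_tmp; exact: cf|exact: cg].
Qed.

HB.instance Definition _ := GRing.isSubmodClosed.Build R[i] (X -> Cplx R)
  dual_pred dual_submod_closed.

Record dual := Dual {
  dual_fun :> X -> Cplx R;
  dual_funP : dual_fun \in dual_pred }.

HB.instance Definition _ := [isSub for dual_fun].
HB.instance Definition _ := [Choice of dual by <:].
HB.instance Definition _ := [SubChoice_isSubLmodule of dual by <:].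

Lemma dual_linear (phi : dual) : linear phi.
Proof. by case: phi => f /= /asboolP[]. Qed.

Lemma dual_continuous (phi : dual) : continuous phi.
Proof. by case: phi => f /= /asboolP[]. Qed.

HB.instance Definition _ (phi : dual) :=
  GRing.isLinear.Build R[i] X (Cplx R) *:%R phi (dual_linear phi).

(* Norms of a normedModType R[i] take their values in the nonnegative reals of
   R[i], whence the injection of the real supremum. *)
Definition dual_norm (phi : dual) : R[i] :=
  (supnorm [set x : X | `|x| <= 1] phi)%:C.

Fact dual_norm_has_sup (phi : dual) :
  has_sup [set Normc.normc (phi x) | x in [set x : X | `|x| <= 1]].
Proof.
split; first by exists (Normc.normc (phi 0)), 0 => //=; rewrite normr0 ler01.
have : bounded_near phi (nbhs (0 : X)).
  by apply/linear_bounded_continuous; exact: dual_continuous.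
move=> /linear_boundedP /pinfty_ex_gt0 [M M0 phiM].
exists (complex.Re M) => _ [x /= x1 <-]; rewrite -lecR RRe_real ?gtr0_real//.
by apply: le_trans (phiM x) _; rewrite ler_piMr// ltW.
Qed.

Fact le_dual_norm1 (phi : dual) (x : X) : `|x| <= 1 -> `|phi x| <= dual_norm phi.
Proof.
move=> x1; rewrite -[`|phi x|]/(Normc.normc (phi x))%:C lecR.
by apply: ub_le_sup; [case: (dual_norm_has_sup phi)|exists x].
Qed.

Fact dual_norm_le (phi : dual) (M : R[i]) : M \is Num.real ->
  (forall x : X, `|x| <= 1 -> `|phi x| <= M) -> dual_norm phi <= M.
Proof.
move=> Mr phiM; rewrite -(RRe_real Mr) lecR.
apply: ge_sup; first by case: (dual_norm_has_sup phi).
by move=> _ [x /= x1 <-]; rewrite -lecR RRe_real// phiM.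
Qed.

Fact dual_norm_real (phi : dual) : dual_norm phi \is Num.real.
Proof. by apply/complex_realP; eexists. Qed.

Fact dual_norm_ge0 (phi : dual) : 0 <= dual_norm phi.
Proof. by apply: le_trans (@le_dual_norm1 phi 0 _); rewrite ?normr0 ?ler01. Qed.

Lemma le_dual_norm (phi : dual) (x : X) : `|phi x| <= dual_norm phi * `|x|.
Proof.
have [->|x0] := eqVneq x 0; first by rewrite linear0 !normr0 mulr0.
have nx0 : 0 < `|x| by rewrite normr_gt0.
have := @le_dual_norm1 phi (`|x|^-1 *: x).
rewrite normrZ normfV normr_id mulVf ?gt_eqF// => /(_ (lexx _)).
by rewrite linearZ/= normrM normfV normr_id ler_pdivrMl// mulrC.
Qed.

Fact dual_normD (phi psi : dual) :
  dual_norm (phi + psi) <= dual_norm phi + dual_norm psi.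
Proof.
apply: dual_norm_le => [|x x1]; first by rewrite realD// dual_norm_real.
by apply: le_trans (ler_normD _ _) _; rewrite lerD// le_dual_norm1.
Qed.

Fact dual_normZ (c : R[i]) (phi : dual) :
  dual_norm (c *: phi) = `|c| * dual_norm phi.
Proof.
have leZ (d : R[i]) (psi : dual) : dual_norm (d *: psi) <= `|d| * dual_norm psi.
  apply: dual_norm_le => [|x x1]; first by rewrite realM ?dual_norm_real ?normr_real.
  by rewrite /= normrM ler_wpM2l// le_dual_norm1.
apply/eqP; rewrite eq_le leZ/=.
have [->|c0] := eqVneq c 0; first by rewrite normr0 mul0r dual_norm_ge0.
rewrite -ler_pdivlMl ?normr_gt0// -normfV.
by apply: le_trans (leZ _ _); rewrite scalerA mulVf// scale1r.
Qed.

Fact dual_norm0_eq0 (phi : dual) : dual_norm phi = 0 -> phi = 0.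
Proof.
move=> phi0; apply/val_inj/funext => x; apply/eqP.
by rewrite -normr_le0 -[leRHS](mul0r `|x|) -phi0 le_dual_norm.
Qed.

HB.instance Definition _ :=
  Lmodule_isNormed.Build R[i] dual dual_normD dual_normZ dual_norm0_eq0.

End DualSpace.

Section Bidual.
Variables (R : realType) (X : normedModType R[i]).

Fact bidual_embed_subproof (x : X) :
  (fun phi : dual X => phi x) \in @dual_pred R (dual X).
Proof.
apply/asboolP; split=> [a phi psi //|].
have evl : linear (fun phi : dual X => phi x : Cplx R) by [].
pose ev : {linear dual X -> Cplx R} :=
  HB.pack (fun phi : dual X => phi x : Cplx R)
    (GRing.isLinear.Build _ _ _ _ _ evl).
apply: (@bounded_linear_continuous _ _ _ ev); apply/linear_boundedP.
near=> M => phi /=; apply: le_trans (le_dual_norm _ _) _.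
rewrite mulrC ler_wpM2r ?dual_norm_ge0//; near: M; apply: nbhs_pinfty_ge.
Unshelve. all: by end_near. Qed.

Definition bidual_embed (x : X) : dual (dual X) := Dual (bidual_embed_subproof x).
End Bidual.

Record directed := Directed {
  dir_sort :> Type;
  dir_le : dir_sort -> dir_sort -> Prop;
  dir_inhabited : inhabited dir_sort;
  dir_refl : forall a, dir_le a a;
  dir_trans : forall a b c, dir_le a b -> dir_le b c -> dir_le a c;
  dir_bound : forall a b, exists c, dir_le a c /\ dir_le b c }.

Definition tails (D : directed) : set_system D :=
  [set A | exists a : D, forall b : D, dir_le a b -> A b].

Arguments tails : clear implicits.

Record net (T : Type) := Net { net_dom : directed; net_fun :> net_dom -> T }.

(* x @ tails D --> p is the usual convergence of the net x indexed by D. *)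
Definition net_lim (T : Type) (x : net T) : set_system T := x @ tails (net_dom x).

(* The coarsest topology on the dual of E making all evaluations continuous. *)
Definition weak_star (R : realType) (E : normedModType R[i]) :=
  initial_topology ((fun phi => phi) : dual E -> {ptws E -> Cplx R}).

HB.instance Definition _ (R : realType) (E : normedModType R[i]) :=
  Topological.on (weak_star E).

Section Polynomials.
Variables (R : realType) (X : normedModType R[i]).
Local Notation C := (Cplx R).
Local Notation bidual := (dual (dual X)).

Definition multilinear_form (m : nat) (A : ('I_m -> X) -> C) : Prop :=
  forall (v : 'I_m -> X) (i : 'I_m),
    linear (fun y : X => A (@dfwith _ (fun=> X) v i y) : C).

Definition symmetric_form (m : nat) (A : ('I_m -> X) -> C) : Prop :=
  forall (s : {perm 'I_m}) (v : 'I_m -> X), A (v \o s) = A v.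

Definition assoc_form (m : nat) (P : X -> C) (A : ('I_m -> X) -> C) : Prop :=
  [/\ multilinear_form A,
      continuous (A : {ptws 'I_m -> X} -> C),
      symmetric_form A
    & forall x, P x = A (fun=> x)].

Definition homog_poly (m : nat) (P : X -> C) : Prop :=
  exists A : ('I_m -> X) -> C, assoc_form P A.

Definition poly_sum (n : nat) (Q : nat -> X -> C) (P : X -> C) : Prop :=
  (forall m, homog_poly m (Q m)) /\ forall x, P x = \sum_(m < n) Q m x.

Definition cont_poly (P : X -> C) : Prop := exists n Q, poly_sum n Q P.

Definition args_cons (m : nat) (x : X) (v : 'I_m -> X) : 'I_m.+1 -> X :=
  fun i => if unlift ord0 i is Some j then v j else x.

(* iterated_lim N A l says that lim_(a_1) ... lim_(a_m) A (N_1 a_1, ..., N_m a_m)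
   exists and equals l, the limit in a_1 being the outermost one. *)
Fixpoint iterated_lim (m : nat) :
    ('I_m -> net X) -> (('I_m -> X) -> C) -> C -> Prop :=
  if m is m'.+1 then fun N A l =>
    exists g : net_dom (N ord0) -> C,
      (forall a, iterated_lim (fun j : 'I_m' => N (lift ord0 j))
                   (fun v => A (args_cons (N ord0 a) v)) (g a)) /\
      g @ tails (net_dom (N ord0)) --> l
  else fun _ A l => A (fun=> 0) = l.

(* Aron-Berner extension of a multilinear form: the common value of the iterated
   limits along all nets of X converging weak-star to the z_i. *)
Definition ext_form (m : nat) (A : ('I_m -> X) -> C) (z : 'I_m -> bidual) : C :=
  xget 0 [set l | forall N : 'I_m -> net X,
    (forall i, bidual_embed (X := X) @ net_lim (N i)
                 --> (z i : weak_star (dual X))) ->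
    iterated_lim N A l].

(* By polarization the symmetric form associated with P is unique, and so is the
   decomposition of a polynomial into homogeneous ones; the choices made by xget
   here and in ext_poly are thus canonical. *)
Definition ext_homog (m : nat) (P : X -> C) (z : bidual) : C :=
  ext_form (xget (fun=> 0) [set A : ('I_m -> X) -> C | assoc_form P A])
    (fun=> z).

Definition ext_poly (P : X -> C) (z : bidual) : C :=
  xget 0 [set l | exists n Q,
    poly_sum n Q P /\ l = \sum_(m < n) ext_homog m (Q m) z].

(* The polynomial-star topology on the bidual: the coarsest one making all the
   extensions of continuous polynomials continuous. *)
Definition polystar :=
  sup_topology (fun P : {P : X -> C | cont_poly P} =>
    Topological.class (initial_topology (ext_poly (proj1_sig P)))).

HB.instance Definition _ := Topological.on polystar.

Definition taylor_series (f : X -> C) (a : X) (Q : nat -> X -> C) : Prop :=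
  (forall m, homog_poly m (Q m)) /\
  exists2 e : R, 0 < e &
    {uniform [set x : X | `|x - a| < e%:C],
      (fun n (x : X) => \sum_(m < n) Q m (x - a)) @ \oo --> f}.

(* Holomorphy on X in the sense of Nachbin and Mujica: near each point, f is the
   uniform sum of a series of continuous homogeneous polynomials. *)
Definition entire (f : X -> C) : Prop := forall a, exists Q, taylor_series f a Q.

(* H_b(X), with the topology of uniform convergence on bounded sets. *)
Definition Hb_set : set {family (bounded_set : set (set X)), X -> C} :=
  [set f : X -> C | entire f /\
     forall A : set X, bounded_set A -> bounded_set (f @` A)].

Definition Hb := set_type Hb_set.
HB.instance Definition _ := Topological.copy Hb (set_type Hb_set).

Definition Hb_fun (f : Hb) : X -> C := set_val f.
Coercion Hb_fun : Hb >-> Funclass.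

(* The extension of f is the sum of the extensions of the (unique) terms of its
   Taylor series at 0. *)
Definition ext_entire (f : Hb) (z : bidual) : C :=
  let Q := xget (fun _ _ => 0) [set Q | taylor_series f 0 Q] in
  limn (fun n => \sum_(m < n) ext_homog m (Q m) z : C).

(* The nonzero continuous multiplicative linear functionals. The operations of
   H_b(X) are the pointwise ones, so the algebraic conditions are expressed on
   the elements of H_b(X) whose underlying functions are a linear combination,
   resp. a product. *)
Definition spectrum : set (Hb -> C) :=
  [set phi : Hb -> C |
    [/\ exists f, phi f != 0,
        continuous phi,
        forall (c : C) (f g h : Hb), (forall x, h x = c * f x + g x) ->
          phi h = c * phi f + phi g
      & forall f g h : Hb, (forall x, h x = f x * g x) ->
          phi h = phi f * phi g]].

Definition gelfand (f : Hb) (phi : Hb -> C) : C := phi f.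

Definition oball (r : R) : set X := [set x | `|x| < r%:C].

Definition poly_fiber (z : bidual) (r : R) : set (Hb -> C) :=
  [set phi | [/\ spectrum phi,
    forall P : Hb, cont_poly P -> phi P = ext_poly P z
  & forall g : Hb, Normc.normc (phi g) <= supnorm (oball r) g]].

Definition cluster_set (r : R) (f : Hb) (z : bidual) : set C :=
  [set l | exists x : net X, [/\ forall a, oball r (x a),
    bidual_embed (X := X) @ net_lim x --> (z : polystar)
  & f @ net_lim x --> l]].

End Polynomials.

(* Main.v *)
Require Import Defs.
From mathcomp Require Import all_boot all_order all_algebra all_fingroup.
From mathcomp Require Import all_classical all_reals all_analysis.
From mathcomp Require Import complex ring lra.

Set Implicit Arguments.
Unset Strict Implicit.
Unset Printing Implicit Defensive.

Import Order.TTheory GRing.Theory Num.Theory.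
Import numFieldNormedType.Exports.

Local Open Scope classical_set_scope.
Local Open Scope ring_scope.
Local Open Scope complex_scope.

(** A function f of bounded type is, on every ball, the uniform limit of the
    partial sums of its Taylor series at 0, with a geometric rate
    ([Hb_taylor_bound]). Polynomial-star convergence controls exactly these
    partial sums. Hence f converges to its extension at z along every filter
    that contains the ball r B_X and converges to z ([cvg_ext_entire]), and every
    phi in the fiber over z, being dominated by the supremum over r B_X, sends f
    to the same value ([gelfand_fiber]). So both sets of the theorem are
    contained in the singleton. The converse inclusions follow from one net of
    r B_X that converges to z in the polynomial-star topology ([homog_net]): f
    converges along it to its extension at z, and the limit along it is a
    character of H_b(X) in the fiber over z ([ext_entire_fiber]).

    The net exists by the theorems of Goldstine and Davie--Gamelin, both proved
    here by descent ([descent]): a nonnegative defect Phi on r B_X has infimum 0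
    as soon as, from each point y and for each small t, the ball contains a point
    y' with Phi y' <= (1 - t/2) Phi y + O(t^2). For Goldstine the defect is the
    sum of |z(phi) - phi(x)|^2 over finitely many functionals; the bound of z by
    the norm of the gradient functional provides the direction of descent
    ([goldstine]). For Davie--Gamelin, let A be a symmetric form of degree m; the
    defect is a weighted sum over k of |A(y^k, z^(m-k)) - A(z^m)|, where y fills k
    variables and the extension at z the other ones. Moving y towards a point x of the ball that is close to z on
    the functionals A(y^(k-1), ., z^(m-k)) replaces the k-th term, up to O(t^2),
    by an average of weights 1 - kt and kt of the terms k and k - 1, and the 0-th
    term vanishes ([descends_symform]).

    The rate of the Taylor series comes from the restrictions of f to complex
    lines. A function on C with an expansion of order 2 at each point
    satisfies the maximum principle on squares, because the mean of a + w over
    w = s, is, -s, -is kills the terms of degree 1 and 2 and leaves O(s^3), which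
    a term e |l|^2 dominates ([max_principle]). On the square of half-side 4 the
    quotient (h(l) - h(0)) / l then has at most half the bound of h, and iterating
    this division gives the rate ([schwarz_iteration]).

    Forms are handled as functions on sequences ([symform]), with the extension
    at z computed by recursion on the arity ([abval]). Two representations of a
    polynomial, by symmetric forms or by homogeneous components, have the same
    extension at z, because both extensions are the limit of the values of the
    polynomial along the same net ([ext_poly_homog]). *)

(** * Real-valued norms *)

Section RealNorm.
Variable R : realType.

(** The norm of a normed module over R[i] takes its values in R[i]; its real part
    lives in an ordered field, where linear arithmetic applies. *)
Definition rnorm (V : normedZmodType R[i]) (v : V) : R := complex.Re `|v|.

Section NormedZmod.
Variable V : normedZmodType R[i].
Implicit Types u v : V.

Lemma rnormE v : `|v| = (rnorm v)%:C.
Proof. by rewrite /rnorm RRe_real// normr_real. Qed.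

Lemma rnorm_ge0 v : 0 <= rnorm v.
Proof. by rewrite -lecR -rnormE normr_ge0. Qed.

Lemma rnorm0 : rnorm (0 : V) = 0.
Proof. by rewrite /rnorm normr0. Qed.

Lemma rnorm_eq0 v : rnorm v = 0 -> v = 0.
Proof. by move=> v0; apply/normr0_eq0; rewrite rnormE v0. Qed.

Lemma rnormN v : rnorm (- v) = rnorm v.
Proof. by rewrite /rnorm normrN. Qed.

Lemma rnorm_distC u v : rnorm (u - v) = rnorm (v - u).
Proof. by rewrite -rnormN opprB. Qed.

Lemma rnormD u v : rnorm (u + v) <= rnorm u + rnorm v.
Proof. by rewrite -lecR rmorphD/= -!rnormE ler_normD. Qed.

Lemma rnormB u v : rnorm (u - v) <= rnorm u + rnorm v.
Proof. by rewrite -(rnormN v) rnormD. Qed.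

Lemma rnorm_distD w u v : rnorm (u - v) <= rnorm (u - w) + rnorm (w - v).
Proof. by rewrite -(subrKA w) rnormD. Qed.

End NormedZmod.

Lemma rnormZ (V : normedModType R[i]) (a : R[i]) (v : V) :
  rnorm (a *: v) = rnorm a * rnorm v.
Proof. by rewrite {1}/rnorm normrZ !rnormE -rmorphM. Qed.

Implicit Types (a b : R[i]) (x : R).

Lemma rnormM a b : rnorm (a * b) = rnorm a * rnorm b.
Proof. by rewrite {1}/rnorm normrM !rnormE -rmorphM. Qed.

Lemma rnorm1 : rnorm (1 : R[i]) = 1.
Proof. by rewrite /rnorm normr1. Qed.

Lemma rnormX a n : rnorm (a ^+ n) = rnorm a ^+ n.
Proof. by elim: n => [|n ih]; rewrite ?expr0 ?rnorm1// !exprS rnormM ih. Qed.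

Lemma rnormV a : rnorm a^-1 = (rnorm a)^-1.
Proof.
have [->|a0] := eqVneq a 0; first by rewrite invr0 rnorm0 invr0.
apply: (@mulfI _ (rnorm a)); last rewrite -rnormM !divff ?rnorm1//.
all: by apply: contra_neq a0 => /rnorm_eq0.
Qed.

Lemma rnormR x : rnorm (x%:C) = `|x|.
Proof. by rewrite /rnorm normc_def/= expr0n/= addr0 sqrtr_sqr. Qed.

Lemma rnorm_normc a : rnorm a = Normc.normc a.
Proof. by []. Qed.

Lemma rnorm_normE a : Num.sqrt (complex.Re a ^+ 2 + complex.Im a ^+ 2) = rnorm a.
Proof. by rewrite /rnorm normc_def. Qed.

Lemma rnorm_sqr a : rnorm a ^+ 2 = complex.Re a ^+ 2 + complex.Im a ^+ 2.
Proof. by rewrite -rnorm_normE sqr_sqrtr// addr_ge0 ?sqr_ge0. Qed.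

Lemma normRe_le a : `|complex.Re a| <= rnorm a.
Proof.
by rewrite -rnorm_normE -sqrtr_sqr ler_wsqrtr// lerDl sqr_ge0.
Qed.

Lemma normIm_le a : `|complex.Im a| <= rnorm a.
Proof.
by rewrite -rnorm_normE -sqrtr_sqr ler_wsqrtr// lerDr sqr_ge0.
Qed.

Lemma Re_le_rnorm a : complex.Re a <= rnorm a.
Proof. exact: le_trans (ler_norm _) (normRe_le a). Qed.

Lemma rnorm_le_ReIm a : rnorm a <= `|complex.Re a| + `|complex.Im a|.
Proof.
rewrite -ler_sqr ?nnegrE ?addr_ge0 ?rnorm_ge0// rnorm_sqr sqrrD !real_normK ?num_real//.
by rewrite lerD2r lerDl mulrn_wge0 ?mulr_ge0.
Qed.

Lemma ReD a b : complex.Re (a + b) = complex.Re a + complex.Re b.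
Proof. by case: a b => ? ? []. Qed.
Lemma ReN a : complex.Re (- a) = - complex.Re a.
Proof. by case: a. Qed.
Lemma ImD a b : complex.Im (a + b) = complex.Im a + complex.Im b.
Proof. by case: a b => ? ? []. Qed.
Lemma ImN a : complex.Im (- a) = - complex.Im a.
Proof. by case: a. Qed.

Lemma rnorm_eq0E (a : R[i]) : (rnorm a == 0) = (a == 0).
Proof. by apply/eqP/eqP => [/rnorm_eq0//|->]; rewrite rnorm0. Qed.

Lemma rnorm_gt0 (a : R[i]) : (0 < rnorm a) = (a != 0).
Proof. by rewrite lt_neqAle rnorm_ge0 andbT eq_sym rnorm_eq0E. Qed.

Lemma rotation a : exists2 c : R[i], rnorm c = 1 & c * a = (rnorm a)%:C.
Proof.
have [->|a0] := eqVneq a 0; first by exists 1; rewrite ?rnorm1// mulr0 rnorm0.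
have na0 : rnorm a != 0 by apply: contra_neq a0 => /rnorm_eq0.
exists ((rnorm a)%:C / a); last by rewrite divfK.
by rewrite rnormM rnormV rnormR ger0_norm ?rnorm_ge0// divff.
Qed.

Section Limits.
Variables (V : normedModType R[i]) (T : Type) (F : set_system T).
Context {FF : Filter F}.

Lemma cvg_rnormP (f : T -> V) (l : V) :
  f @ F --> l <-> forall e : R, 0 < e -> \forall t \near F, rnorm (l - f t) < e.
Proof.
split=> [/cvgrPdist_lt fl e e0|fl].
  have := fl e%:C; rewrite ltcR => /(_ e0); apply: filterS => t.
  by rewrite rnormE ltcR.
apply/cvgrPdist_lt => e e0.
have er : e = (complex.Re e)%:C by rewrite RRe_real// gtr0_real.
move: e0; rewrite er ltcR => /fl; apply: filterS => t.
by rewrite rnormE ltcR.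
Qed.

End Limits.

Lemma cvg_rnorm_unique (V : normedModType R[i]) (T : Type) (F : set_system T)
  {FF : ProperFilter F} (f : T -> V) (l l' : V) :
  f @ F --> l -> f @ F --> l' -> l = l'.
Proof.
move=> /cvg_rnormP fl /cvg_rnormP fl'; apply/eqP; rewrite -subr_eq0; apply/eqP.
apply: rnorm_eq0; apply/eqP; rewrite eq_le rnorm_ge0 andbT.
apply/ler_addgt0Pr => e e0; rewrite add0r.
have e20 : 0 < e / 2 by rewrite divr_gt0.
have [t [ht ht']] := filter_ex (filterI (fl _ e20) (fl' _ e20)).
rewrite (le_trans (rnorm_distD (f t) _ _))// (splitr e) lerD//.
  by rewrite ltW.
by rewrite rnorm_distC ltW.
Qed.

End RealNorm.

(** * The maximum principle for twice expandable functions *)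

Section OneVariable.
Variable R : realType.
Implicit Types (h : R[i] -> R[i]) (a b c w l : R[i]).

(** This form of twice complex differentiability is stable under the division
    of [jet2_quotient] and is what the four-point mean of [jet2_no_local_max]
    consumes. *)
Definition jet2 h a := exists c1 c2 (K d : R), [/\ 0 < d, 0 <= K &
  forall w, rnorm w < d ->
    rnorm (h (a + w) - (h a + c1 * w + c2 * w ^+ 2)) <= K * rnorm w ^+ 3].

Lemma jet2_lipschitz h a : jet2 h a -> exists (K d : R),
  [/\ 0 < d, 0 <= K & forall w, rnorm w < d ->
    rnorm (h (a + w) - h a) <= K * rnorm w].
Proof.
move=> [c1 [c2 [K [d [d0 K0 hd]]]]].
exists (rnorm c1 + rnorm c2 + K), (Num.min d 1).
split; [by rewrite lt_min d0 ltr01|by rewrite !addr_ge0 ?rnorm_ge0|move=> w].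
rewrite lt_min => /andP[wd w1].
have -> : h (a + w) - h a = (h (a + w) - (h a + c1 * w + c2 * w ^+ 2)) +
  (c1 * w + c2 * w ^+ 2) by ring.
apply: le_trans (rnormD _ _) _; apply: le_trans (lerD (hd w wd) (rnormD _ _)) _.
rewrite (rnormM c1) (rnormM c2) rnormX.
have := rnorm_ge0 w; have := rnorm_ge0 c1; have := rnorm_ge0 c2.
set n := rnorm w in w1 *; set x := rnorm c1; set y := rnorm c2 => y0 x0 n0.
have n2 : n ^+ 2 <= n by rewrite expr2 ler_piMr// ltW.
have n3 : n ^+ 3 <= n by rewrite exprS (le_trans _ n2)// expr2 ler_wpM2l// exprS ler_piMr// ltW.
rewrite !mulrDl addrC -!addrA lerD2l lerD ?ler_wpM2l//.
Qed.

(** Over w = s, is, -s, -is the mean of c h(a + w) differs from c h(a) by O(s^3),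
    while the mean of |a + w|^2 exceeds |a|^2 by s^2; for small s the second
    effect wins. *)
Lemma jet2_no_local_max h a c (e d : R) : jet2 h a -> 0 < e -> 0 < d ->
  let u l := complex.Re (c * h l) + e * rnorm l ^+ 2 in
  exists2 w, rnorm w <= d & u a < u (a + w).
Proof.
move=> [c1 [c2 [K [d' [d'0 K0 hd']]]]] e0 d0 u.
apply: contrapT => nmax.
have umax w : rnorm w <= d -> u (a + w) <= u a.
  by move=> wd; rewrite leNgt; apply/negP => aw; apply: nmax; exists w.
(* s is small enough for the cubic rest to be dominated by e s^2. *)
pose s := Num.min (Num.min d (d' / 2)) (e / (2 * (rnorm c * K + 1))).
have cK : 0 <= rnorm c * K by rewrite mulr_ge0 ?rnorm_ge0.
have s0 : 0 < s by rewrite !lt_min d0 !divr_gt0//; lra.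
have sd : s <= d by rewrite /s !ge_min lexx.
have sd' : s < d'.
  apply: (@le_lt_trans _ _ (d' / 2)); last lra.
  by rewrite /s !ge_min lexx orbT.
have se : rnorm c * K * s < e.
  apply: (@le_lt_trans _ _ (rnorm c * K * (e / (2 * (rnorm c * K + 1))))).
    by rewrite ler_wpM2l// /s ge_min lexx orbT.
  rewrite mulrA ltr_pdivrMr; nra.
pose E w := h (a + w) - (h a + c1 * w + c2 * w ^+ 2).
pose S : R[i] := s%:C.
have i2 : 'i * 'i = -1 :> R[i] by rewrite -expr2 sqr_i.
have nS : rnorm S = s by rewrite rnormR ger0_norm// ltW.
have ni : rnorm ('i : R[i]) = 1 by rewrite rnorm_normc /= expr0n/= expr1n add0r sqrtr1.
have nE w : rnorm w = s -> rnorm (c * E w) <= rnorm c * K * s ^+ 3.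
  move=> ws; rewrite rnormM -mulrA ler_wpM2l ?rnorm_ge0// -ws hd'// ws//.
have niS : rnorm ('i * S) = s by rewrite rnormM ni mul1r.
(* The powers of 'i cancel the terms of degree 1 and 2. *)
have sum4 : c * h (a + S) + c * h (a - S) + c * h (a + 'i * S) + c * h (a - 'i * S) =
   (c * h a + c * h a + c * h a + c * h a) +
   (c * E S + c * E (- S) + c * E ('i * S) + c * E (- ('i * S))).
  rewrite /E.
  have -> : (- S) ^+ 2 = S ^+ 2 by rewrite sqrrN.
  have -> : (- ('i * S)) ^+ 2 = - S ^+ 2 by rewrite sqrrN exprMn expr2 i2 mulN1r.
  have -> : ('i * S) ^+ 2 = - S ^+ 2 by rewrite exprMn expr2 i2 mulN1r.
  by ring.
have /(congr1 (@complex.Re R)) := sum4.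
have bndE w : rnorm w = s -> - (rnorm c * K * s ^+ 3) <= complex.Re (c * E w).
  move=> /nE; have := normRe_le (c * E w); rewrite ler_norml => /andP[+ _]; lra.
have := bndE _ nS; have := bndE (- S); rewrite rnormN => /(_ nS).
have := bndE _ niS; have := bndE (- ('i * S)); rewrite rnormN => /(_ niS).
have := umax S; have := umax (- S); rewrite rnormN nS => /(_ sd) + /(_ sd).
have := umax ('i * S); have := umax (- ('i * S)); rewrite rnormN niS => /(_ sd) + /(_ sd).
rewrite /u !rnorm_sqr !(ReD,ReN,ImD,ImN).
have -> : complex.Re S = s by [].
have -> : complex.Im S = 0 by [].
have -> : complex.Re ('i * S) = 0 by rewrite /= !(mul0r,mulr0,mul1r) subrr.
have -> : complex.Im ('i * S) = s by rewrite /= !(mul0r,mulr0,mul1r) add0r.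
have : rnorm c * K * s ^+ 3 < e * s ^+ 2.
  by rewrite exprS mulrA ltr_pM2r ?exprn_gt0.
move: (rnorm c * K * s ^+ 3) (complex.Re a) (complex.Im a) => T a1 a2.
have quad : e * ((a1 + s) ^+ 2 + (a2 + 0) ^+ 2) + e * ((a1 - s) ^+ 2 + (a2 - 0) ^+ 2) +
  e * ((a1 + 0) ^+ 2 + (a2 + s) ^+ 2) + e * ((a1 - 0) ^+ 2 + (a2 - s) ^+ 2) =
  4 * (e * (a1 ^+ 2 + a2 ^+ 2)) + 4 * (e * s ^+ 2) by ring.
move: quad.
set q := e * s ^+ 2.
do 9![move: (complex.Re _) => ?].
do 5![move: (e * (_ + _)) => ?].
lra.
Qed.

Definition square (p : R) : set R[i] :=
  [set l | `|complex.Re l| <= p /\ `|complex.Im l| <= p].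

(** Applied with c such that c h(l) is the modulus of h at the chosen point l, the
    perturbed function Re(c h) + e |.|^2 attains its maximum over the compact
    square where |l| >= p, by [jet2_no_local_max]; then e tends to 0. The points
    of the square with |l| >= p play the role of its boundary, and a square is a
    product of intervals, hence compact. *)
Lemma max_principle h (p M : R) : 0 < p -> (forall a, jet2 h a) ->
  (forall l, square p l -> p <= rnorm l -> rnorm (h l) <= M) ->
  forall l, square p l -> rnorm (h l) <= M.
Proof.
move=> p0 jh bnd l0 sl0.
have [c c1 cl0] := rotation (h l0).
apply/ler_addgt0Pr => e' e'0.
pose e := e' / (2 * p ^+ 2).
have pp : 0 < 2 * p ^+ 2 by rewrite mulr_gt0// exprn_gt0.
have e0 : 0 < e by rewrite divr_gt0.
pose u l := complex.Re (c * h l) + e * rnorm l ^+ 2.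
pose I : set R := `[- p, p]%classic.
pose v (q : R * R) := u (Complex q.1 q.2).
have cv : continuous v.
  move=> [x y]; apply/cvgrPdist_lt => eps eps0; rewrite /v/=.
  have [K [d [d0 K0 hK]]] := jet2_lipschitz (jh (Complex x y)).
  set a := Complex x y in hK *.
  have ra := rnorm_ge0 a.
  pose B := K + e * (2 * rnorm a + 1).
  have B0 : 0 <= B.
    rewrite /B; apply: addr_ge0 => //; apply: mulr_ge0; first exact: ltW.
    lra.
  pose s := Num.min (Num.min d 1) (eps / (B + 1)).
  have s0 : 0 < s by rewrite !lt_min d0 ltr01 divr_gt0//; lra.
  have [sd s1 sB] : [/\ s <= d, s <= 1 & s <= eps / (B + 1)].
    by rewrite /s !ge_min !lexx !orbT.
  near=> q.
  have [q1 q2] : `|x - q.1| < s / 2 /\ `|y - q.2| < s / 2.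
    split; near: q.
      by apply: (@cvgr_dist_lt _ _ _ _ _ _ x); [exact: cvg_fst|rewrite divr_gt0].
    by apply: (@cvgr_dist_lt _ _ _ _ _ _ y); [exact: cvg_snd|rewrite divr_gt0].
  pose w : R[i] := Complex (q.1 - x) (q.2 - y).
  have ws : rnorm w < s.
    apply: le_lt_trans (rnorm_le_ReIm _) _.
    by rewrite /= (distrC q.1) (distrC q.2); lra.
  have qE : Complex q.1 q.2 = a + w.
    by rewrite /a /w; apply/eqP; rewrite eq_complex /=; apply/andP; split; apply/eqP; ring.
  rewrite qE distrC /u.
  have h1 : `|complex.Re (c * h (a + w)) - complex.Re (c * h a)| <= K * rnorm w.
    rewrite -ReN -ReD -mulrN -mulrDr (le_trans (normRe_le _))// rnormM c1 mul1r hK//.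
    exact: lt_le_trans ws sd.
  have h2 : `|rnorm (a + w) ^+ 2 - rnorm a ^+ 2| <= (2 * rnorm a + 1) * rnorm w.
    rewrite subr_sqr normrM mulrC; apply: ler_pM => //.
      rewrite ger0_norm ?addr_ge0 ?rnorm_ge0//.
      have := rnormD a w; lra.
    have := rnormD a w; have := rnormB (a + w) w; rewrite addrK ler_norml; lra.
  have -> : complex.Re (c * h (a + w)) + e * rnorm (a + w) ^+ 2 -
     (complex.Re (c * h a) + e * rnorm a ^+ 2) =
    (complex.Re (c * h (a + w)) - complex.Re (c * h a)) +
     e * (rnorm (a + w) ^+ 2 - rnorm a ^+ 2) by ring.
  apply: le_lt_trans (ler_normD _ _) _.
  rewrite normrM (gtr0_norm e0).
  have h3 : B * rnorm w < eps.
    apply: (@le_lt_trans _ _ (B * (eps / (B + 1)))).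
      by rewrite ler_wpM2l// (le_trans (ltW ws)).
    rewrite mulrA ltr_pdivrMr; nra.
  apply: le_lt_trans h3; rewrite /B mulrDl -(mulrA e).
  by apply: lerD => //; apply: ler_wpM2l => //; exact: ltW.
have [|||[x y]] := @compact_EVT_max _ R v (I `*` I).
- by exists (0, 0); split; rewrite /I/= in_itv /= oppr_le0 (ltW p0).
- by apply: compact_setX; exact: segment_compact.
- exact: continuous_subspaceT.
rewrite inE /= => -[]; rewrite /I/= !in_itv/= -!ler_norml => hx hy vmax.
pose a : R[i] := Complex x y.
have umax l : square p l -> u l <= u a.
  move=> [l1 l2]; have := vmax (complex.Re l, complex.Im l); rewrite /v/=.
  have -> : Complex (complex.Re l) (complex.Im l) = l by case: l {l1 l2}.
  by apply; rewrite inE; split; rewrite /I/= in_itv/= -ler_norml.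
have hrn l : rnorm l ^+ 2 = complex.Re l ^+ 2 + complex.Im l ^+ 2 by exact: rnorm_sqr.
have sq2 l : square p l -> rnorm l ^+ 2 <= 2 * p ^+ 2.
  move=> [l1 l2]; rewrite hrn mulr_natl mulr2n lerD//.
    by rewrite -real_normK ?num_real// lerXn2r// nnegrE// ltW.
  by rewrite -real_normK ?num_real// lerXn2r// nnegrE// ltW.
have ee : e * (2 * p ^+ 2) = e' by rewrite /e divfK// gt_eqF.
have : p <= rnorm a.
  rewrite leNgt; apply/negP => pa.
  have d0 : 0 < p - rnorm a by rewrite subr_gt0.
  have [w wd] := @jet2_no_local_max h a c e _ (jh a) e0 d0.
  apply/negP; rewrite -leNgt; apply: umax; split.
    by apply: le_trans (normRe_le _) _; have := rnormD a w; lra.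
  by apply: le_trans (normIm_le _) _; have := rnormD a w; lra.
move=> pa; have sa : square p a by [].
have := umax _ sl0; rewrite /u cl0 /=.
have := bnd _ sa pa; have := Re_le_rnorm (c * h a); rewrite rnormM c1 mul1r.
have : e * rnorm a ^+ 2 <= e' by rewrite -ee ler_wpM2l ?sq2// ltW.
have : 0 <= e * rnorm l0 ^+ 2 by rewrite mulr_ge0 ?sqr_ge0// ltW.
lra.
Unshelve. all: by end_near. Qed.

End OneVariable.

(** * Schwarz iteration *)

Section Schwarz.
Variable R : realType.
Implicit Types (h : R[i] -> R[i]) (a w l : R[i]) (b : nat -> R[i]).

(** The constant may depend on the order k: only the finite expansions matter, and
    this is what survives the division by the variable. *)
Definition expands h b := forall k, exists (K d : R), [/\ 0 < d, 0 <= K &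
  forall w, rnorm w < d ->
    rnorm (h w - \sum_(j < k) b j * w ^+ j) <= K * rnorm w ^+ k].

(** The value b1 at 0 is the derivative of h at 0 when b0 = h 0. *)
Definition quotient h (b0 b1 : R[i]) l := if l == 0 then b1 else (h l - b0) / l.

Lemma expands0 h b : expands h b -> h 0 = b 0%N.
Proof.
move=> /(_ 1%N)[K [d [d0 K0 hd]]]; have := hd 0; rewrite rnorm0 => /(_ d0).
rewrite big_ord1 expr0 mulr1 expr1 mulr0 => hb0.
apply/eqP; rewrite -subr_eq0 -rnorm_eq0E eq_le hb0 rnorm_ge0//.
Qed.

Lemma expands_jet2 h b : expands h b -> jet2 h 0.
Proof.
move=> hb; have h0 := expands0 hb; have [K [d [d0 K0 hd]]] := hb 3%N.
exists (b 1%N), (b 2%N), K, d; split => // w /hd.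
by rewrite !big_ord_recr big_ord0/= add0r expr0 mulr1 expr1 h0 add0r.
Qed.

Lemma expands_quotient h b : expands h b ->
  expands (quotient h (b 0%N) (b 1%N)) (fun j => b j.+1).
Proof.
move=> hb k; have [K [d [d0 K0 hd]]] := hb k.+1.
exists (K + rnorm (b 1%N)), d; split=> //; first by rewrite addr_ge0 ?rnorm_ge0.
move=> w wd; rewrite /quotient; have [->|w0] := eqVneq w 0.
  case: k {hd} => [|k]; first by rewrite big_ord0 subr0 expr0 mulr1 lerDr.
  rewrite big_ord_recl/= expr0 mulr1 big1 ?addr0 ?subrr ?rnorm0//.
    by rewrite exprS mul0r mulr0.
  by move=> i _; rewrite exprS mul0r mulr0.
have -> : (h w - b 0%N) / w - \sum_(j < k) b j.+1 * w ^+ j =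
  (h w - \sum_(j < k.+1) b j * w ^+ j) / w.
  rewrite big_ord_recl/= expr0 mulr1 opprD addrA [RHS]mulrDl; congr (_ + _).
  rewrite mulNr; congr (- _); rewrite mulr_suml; apply: eq_bigr => i _.
  by rewrite /bump/= add1n exprSr mulrA mulfK.
rewrite rnormM rnormV ler_pdivrMr ?rnorm_gt0// -mulrA -exprSr.
by apply: le_trans (hd w wd) _; rewrite ler_wpM2r ?exprn_ge0 ?rnorm_ge0// lerDl rnorm_ge0.
Qed.

(** Euclidean division of the expansion of h - b0 at a by a + w gives the
    coefficients e0, e1, e2; the rest is O(w^3), divided by a + w, which stays
    away from 0. *)
Lemma jet2_quotient h (b0 b1 a : R[i]) : a != 0 -> jet2 h a ->
  jet2 (quotient h b0 b1) a.
Proof.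
move=> a0 [c1 [c2 [K [d [d0 K0 hd]]]]].
pose e0 := (h a - b0) / a; pose e1 := (c1 - e0) / a; pose e2 := (c2 - e1) / a.
have na : 0 < rnorm a by rewrite rnorm_gt0.
exists e1, e2, ((K + rnorm e2) * (2 / rnorm a)), (Num.min d (rnorm a / 2)).
split; first by rewrite lt_min d0 divr_gt0.
  by rewrite !mulr_ge0 ?addr_ge0 ?rnorm_ge0// invr_ge0 rnorm_ge0.
move=> w; rewrite lt_min => /andP[wd wa].
have naw : rnorm a / 2 < rnorm (a + w).
  by have := rnormB (a + w) w; rewrite addrK; lra.
have aw0 : a + w != 0 by rewrite -rnorm_gt0; lra.
rewrite /quotient (negbTE a0) (negbTE aw0) -/e0.
have -> : (h (a + w) - b0) / (a + w) - (e0 + e1 * w + e2 * w ^+ 2) =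
  ((h (a + w) - (h a + c1 * w + c2 * w ^+ 2)) - e2 * w ^+ 3) / (a + w).
  apply: (mulIf aw0); rewrite mulrBl !divfK//.
  have E0 : h a - b0 = e0 * a by rewrite /e0 divfK.
  have E1 : c1 = e1 * a + e0 by rewrite /e1 divfK// subrK.
  have E2 : c2 = e2 * a + e1 by rewrite /e2 divfK// subrK.
  have -> : h a = e0 * a + b0 by rewrite -E0 subrK.
  by rewrite E1 E2; ring.
rewrite rnormM rnormV ler_pdivrMr ?rnorm_gt0//.
have h1 : rnorm (h (a + w) - (h a + c1 * w + c2 * w ^+ 2) - e2 * w ^+ 3) <=
   (K + rnorm e2) * rnorm w ^+ 3.
  apply: le_trans (rnormB _ _) _; rewrite (rnormM e2) rnormX mulrDl lerD2r.
  exact: hd.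
apply: le_trans h1 _.
have -> : (K + rnorm e2) * (2 / rnorm a) * rnorm w ^+ 3 * rnorm (a + w) =
  (K + rnorm e2) * rnorm w ^+ 3 * (rnorm (a + w) / (rnorm a / 2)).
  by rewrite invf_div; ring.
rewrite ler_peMr ?mulr_ge0 ?exprn_ge0 ?addr_ge0 ?rnorm_ge0//.
by rewrite ler_pdivlMr ?divr_gt0// mul1r ltW.
Qed.

(** Where |l| >= 4 in the square, the quotient (h(l) - h(0)) / l is at most
    2M / 4, so by the maximum principle the division by the variable halves the
    bound; its value at 1 is h(1) minus the first coefficient. *)
Lemma schwarz_iteration k h b (M : R) :
  (forall a, a != 0 -> jet2 h a) -> expands h b ->
  (forall l, square 4 l -> rnorm (h l) <= M) ->
  rnorm (h 1 - \sum_(j < k) b j) <= M / 2 ^+ k.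
Proof.
elim: k h b M => [|k ih] h b M hj hb hM.
  rewrite big_ord0 subr0 expr0 divr1; apply: hM; split=> /=; rewrite ?normr1 ?normr0; lra.
have h0 := expands0 hb.
have := ih _ _ (M / 2) _ (expands_quotient hb).
rewrite /quotient oner_eq0 divr1 big_ord_recl/= opprD addrA exprS invfM mulrA; apply.
  by move=> a a0; apply: jet2_quotient => //; exact: hj.
apply: max_principle => //.
  move=> a; have [->|a0] := eqVneq a 0; first exact: expands_jet2 (expands_quotient hb).
  by apply: jet2_quotient => //; exact: hj.
move=> l sl l4.
have l0 : l != 0 by rewrite -rnorm_gt0; lra.
rewrite (negbTE l0) rnormM rnormV ler_pdivrMr ?rnorm_gt0//.
have M1 := hM _ sl.
have M2 : rnorm (b 0%N) <= M.
  by rewrite -h0; apply: hM; split; rewrite /= normr0.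
have := rnormB (h l) (b 0%N); have := rnorm_ge0 (h l).
nra.
Qed.

End Schwarz.

(** * Symmetric forms and their extension to the bidual *)

Section DualFacts.
Variables (R : realType) (E : normedModType R[i]).
Implicit Types (f : E -> Cplx R) (phi : dual E).

Lemma le_rnorm_dual phi x : rnorm (phi x) <= rnorm phi * rnorm x.
Proof. by have := le_dual_norm phi x; rewrite -lecR rmorphM /= -!rnormE. Qed.

Lemma rnorm_dual_le phi (K : R) : 0 <= K ->
  (forall x, rnorm (phi x) <= K * rnorm x) -> rnorm phi <= K.
Proof.
move=> K0 phiK; rewrite -lecR -rnormE; apply: dual_norm_le.
  by apply/complex_realP; exists K.
move=> x; rewrite !rnormE -[1]/(1%:C) !lecR => x1.
by apply: le_trans (phiK x) _; rewrite ler_piMr.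
Qed.

Lemma mem_dual_pred f (K : R) : linear f ->
  (forall x, rnorm (f x) <= K * rnorm x) -> f \in @dual_pred R E.
Proof.
move=> lf fK; apply/asboolP; split=> // x; apply/cvg_rnormP => e e0.
have K1 : 0 < `|K| + 1 by have := normr_ge0 K; lra.
have /cvg_rnormP/(_ (e / (`|K| + 1))) : id @ x --> x by [].
rewrite divr_gt0// => /(_ isT); apply: filterS => y /=.
rewrite ltr_pdivlMr// => xy; have -> : f x - f y = f (x - y).
   have h : f (- y + x) = - f y + f x by have := lf (-1) y x; rewrite !scaleN1r.
    by rewrite [x - y]addrC h [RHS]addrC.
apply: le_lt_trans (fK _) (le_lt_trans _ xy).
by rewrite mulrC ler_wpM2l ?rnorm_ge0//; have := ler_norm K; lra.
Qed.

(** Total, with value 0 outside the dual, so that [abval] can be defined by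
    recursion on arbitrary functions; [dualizeE] recovers f once f is known to be
    linear and bounded. *)
Definition dualize f : dual E := insubd (0 : dual E) f.

Lemma dualizeE f : f \in @dual_pred R E -> dualize f = f :> (E -> Cplx R).
Proof. by move=> fd; rewrite /dualize -[LHS]/(val _) insubdK. Qed.

Lemma dualizeP (a : R[i]) f g : f \in @dual_pred R E -> g \in @dual_pred R E ->
  dualize (fun x => a * f x + g x) = a *: dualize f + dualize g.
Proof.
move=> fd gd.
have hd : (fun x => a * f x + g x) \in @dual_pred R E.
  have [[_ hD] hZ] := @dual_submod_closed R E.
  exact: (hD _ _ (hZ a f fd) gd).
apply: val_inj; apply/funext => x.
change (dualize (fun x => a * f x + g x) x = a * dualize f x + dualize g x).
have e k (kd : k \in @dual_pred R E) : dualize k x = k x := congr1 (@^~ x) (dualizeE kd).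
exact: etrans (e _ hd) (esym (congr2 (fun u v => a * u + v) (e _ fd) (e _ gd))).
Qed.

Lemma rnorm_dualize_le f (K : R) : 0 <= K -> f \in @dual_pred R E ->
  (forall x, rnorm (f x) <= K * rnorm x) -> rnorm (dualize f) <= K.
Proof. by move=> K0 fd fK; apply: rnorm_dual_le => // x; rewrite dualizeE. Qed.

End DualFacts.

Section SymForms.
Variables (R : realType) (X : normedModType R[i]).
Implicit Types (m : nat) (M : R) (F G : seq X -> Cplx R) (s t : seq X) (x y : X).

Definition head_linear m F :=
  forall s, (size s).+1 = m -> linear (fun x => F (x :: s)).

Definition perm_invariant m F :=
  forall s t, size s = m -> perm_eq s t -> F s = F t.

Lemma symlinear_cons m F x : head_linear m.+1 F -> perm_invariant m.+1 F ->
  head_linear m (fun s => F (x :: s)) /\ perm_invariant m (fun s => F (x :: s)).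
Proof.
move=> lF pF; split=> [s sm a y y'|s t sm st]; last first.
  by apply: pF; rewrite /= ?sm// perm_cons.
have sw u : F [:: x, u & s] = F [:: u, x & s].
  by apply: pF; rewrite /= ?sm//; apply/seq.permP => P /=; rewrite addnCA.
by rewrite !sw (lF (x :: s)) //= sm.
Qed.

(** The m-linear symmetric forms with norm at most M, as functions on sequences of
    length m; with symmetry, linearity in the head gives linearity everywhere. *)
Record symform m M F : Prop := SymForm {
  symform_linear : head_linear m F;
  symform_bound : forall s, size s = m ->
    rnorm (F s) <= M * \prod_(x <- s) rnorm x;
  symform_perm : perm_invariant m F }.

Lemma symform_cons m M F x : symform m.+1 M F ->
  symform m (M * rnorm x) (fun s => F (x :: s)).
Proof.
move=> [lF bF pF]; have [lFx pFx] := symlinear_cons x lF pF; split=> // s sm.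
by have := bF (x :: s); rewrite big_cons mulrA /= sm; apply.
Qed.

Lemma symform_head_dual m M F s : symform m.+1 M F -> size s = m ->
  (fun x => F (x :: s)) \in @dual_pred R X.
Proof.
move=> FF sm; apply: (@mem_dual_pred _ _ _ (M * \prod_(x <- s) rnorm x)).
  by apply: (symform_linear FF); rewrite sm.
by move=> x; rewrite mulrAC -mulrA; have := symform_bound FF (s := x :: s);
  rewrite big_cons /= sm; apply.
Qed.

Lemma symform_comb m M M' F G (a : R[i]) : symform m M F -> symform m M' G ->
  symform m (rnorm a * M + M') (fun s => a * F s + G s).
Proof.
move=> [lF bF pF] [lG bG pG]; split=> [s sm c y y'|s sm|s t sm st].
- rewrite lF// lG// scalerDr -![_ *: _]/(_ * _) !mulrDr mulrCA.
  exact: addrACA.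
- rewrite mulrDl; apply: le_trans (rnormD _ _) _.
  by rewrite rnormM lerD ?bG// -mulrA ler_wpM2l ?rnorm_ge0 ?bF.
- by rewrite (pF s t)// (pG s t).
Qed.

Section AronBerner.
Variable z : dual (dual X).

(** The head of the sequence is the outermost variable of the iterated limits: z is
    applied last, to the functional x |-> F (x, z, ..., z). *)
Fixpoint abval m F : Cplx R :=
  if m is m'.+1 then z (dualize (fun x => abval m' (fun s => F (x :: s))))
  else F [::].

Lemma eq_abval m F G : (forall s, size s = m -> F s = G s) ->
  abval m F = abval m G.
Proof.
elim: m F G => [|m ih] F G FG /=; first by rewrite FG.
congr (z (dualize _)); apply/funext => x; apply: ih => s sm.
by rewrite FG//= sm.
Qed.

(** Bound and linearity are proved together: both are needed for the function
    x |-> F (x, z, ..., z) to be a continuous functional, on which the next step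
    evaluates z. *)
Lemma abval_spec m : (forall M F, 0 <= M -> symform m M F ->
    rnorm (abval m F) <= M * rnorm z ^+ m) /\
  (forall M M' F G (a : R[i]), 0 <= M -> 0 <= M' -> symform m M F -> symform m M' G ->
    abval m (fun s => a * F s + G s) = a * abval m F + abval m G).
Proof.
elim: m => [|m [ihb ihl]].
  split=> //= M F M0 [_ bF _]; have := bF [::] erefl.
  by rewrite big_nil expr0.
have dl M F : 0 <= M -> symform m.+1 M F -> 
    (fun x => abval m (fun s => F (x :: s))) \in @dual_pred R X /\
    forall x, rnorm (abval m (fun s => F (x :: s))) <= M * rnorm z ^+ m * rnorm x.
  move=> M0 FF; have bd x : rnorm (abval m (fun s => F (x :: s))) <= M * rnorm z ^+ m * rnorm x.
    rewrite mulrAC; apply: ihb; first by rewrite mulr_ge0 ?rnorm_ge0.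
    exact: symform_cons.
  split=> //; apply: mem_dual_pred bd => a x y.
  rewrite -[RHS]/(a * _ + _) -(ihl _ _ _ _ a _ _ (symform_cons x FF) (symform_cons y FF)).
  - by apply: eq_abval => s sm; rewrite (symform_linear FF)//= sm.
  - by rewrite mulr_ge0 ?rnorm_ge0.
  - by rewrite mulr_ge0 ?rnorm_ge0.
split=> [M F M0 FF|M M' F G a M0 M'0 FF FG] /=.
  have [dF bF] := dl _ _ M0 FF.
  apply: le_trans (le_rnorm_dual _ _) _; rewrite mulrC exprSr mulrA.
  apply: ler_wpM2r; first exact: rnorm_ge0.
  by apply: rnorm_dualize_le => //; rewrite mulr_ge0 ?exprn_ge0 ?rnorm_ge0.
have [dF _] := dl _ _ M0 FF; have [dG _] := dl _ _ M'0 FG.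
set f := (fun x => abval m (fun s => F (x :: s))) in dF *.
set g := (fun x => abval m (fun s => G (x :: s))) in dG *.
have <- : z (a *: dualize f + dualize g) = a * z (dualize f) + z (dualize g).
  exact: (dual_linear z a (dualize f) (dualize g)).
have <- := dualizeP a dF dG.
congr (z (dualize _)); apply/funext => x.
apply: (ihl _ _ _ _ a _ _ (symform_cons x FF) (symform_cons x FG)).
all: by rewrite mulr_ge0 ?rnorm_ge0.
Qed.

(** The last j variables are set to z, the variables in s remain free. *)
Definition partval j F s := abval j (fun t => F (s ++ t)).

Lemma partval0 F s : partval 0 F s = F s.
Proof. by rewrite /partval /= cats0. Qed.

Lemma symform_cat k j M F s : 0 <= M -> size s = k -> symform (k + j) M F ->
  symform j (M * \prod_(x <- s) rnorm x) (fun t => F (s ++ t)).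
Proof.
move=> M0; elim: s k M F M0 => [|x s ih] k M F M0 sk FF.
  by rewrite big_nil mulr1; move: FF; rewrite -sk.
rewrite big_cons mulrA -/cat; case: k sk FF => // k [sk] FF.
apply: (ih k _ (fun s => F (x :: s))) => //; first by rewrite mulr_ge0 ?rnorm_ge0.
exact: symform_cons.
Qed.

Lemma prod_rnorm_ge0 s : 0 <= \prod_(x <- s) rnorm x.
Proof. by apply: prodr_ge0 => x _; exact: rnorm_ge0. Qed.

(** This gives a symmetric form in the free variables, although the extension of
    F is in general not symmetric on the bidual. *)
Lemma symform_partval k j M F : 0 <= M -> symform (k + j) M F ->
  symform k (M * rnorm z ^+ j) (partval j F).
Proof.
move=> M0 FF; have [ab al] := abval_spec j.
split=> [s sk a x y|s sk|s t sk st].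
- rewrite -[RHS]/(a * _ + _).
  rewrite -(al _ _ _ _ a _ _ (symform_cat M0 _ FF) (symform_cat M0 _ FF))
    ?mulr_ge0 ?prod_rnorm_ge0//=.
  by apply: eq_abval => t tj; rewrite /= (symform_linear FF)// size_cat tj -addSn sk.
- rewrite mulrAC; apply: ab; first by rewrite mulr_ge0 ?prod_rnorm_ge0.
  exact: symform_cat FF.
- apply: eq_abval => u uj; apply: (symform_perm FF); first by rewrite size_cat sk uj.
  by rewrite perm_cat2r.
Qed.

Lemma abval_cons_dual m M F : 0 <= M -> symform m.+1 M F ->
  (fun x => abval m (fun s => F (x :: s))) \in @dual_pred R X.
Proof.
move=> M0 FF.
exact: (symform_head_dual (@symform_partval 1 m M F M0 FF) (erefl : size [::] = 0%N)).
Qed.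

(** The last of the free variables is the next one to be replaced by z. *)
Lemma partvalS j F s : partval j.+1 F s = z (dualize (fun x => partval j F (rcons s x))).
Proof.
rewrite /partval /=; congr (z (dualize _)); apply/funext => x.
by apply: eq_abval => t _; rewrite cat_rcons.
Qed.

End AronBerner.

Lemma abval_embed x m M F : 0 <= M -> symform m M F ->
  abval (bidual_embed x) m F = F (nseq m x).
Proof.
elim: m M F => [//|m ih] M F M0 FF /=.
rewrite dualizeE; last exact: abval_cons_dual FF.
by rewrite (ih (M * rnorm x) (fun s => F (x :: s))) ?mulr_ge0 ?rnorm_ge0//; exact: symform_cons.
Qed.

End SymForms.

(** * Descent and Goldstine's theorem *)

Section Descent.
Variable R : realType.

(** If the infimum d of Phi is positive, a point with Phi y < d + t^2 has a
    successor with d <= (1 - t/2) (d + t^2) + C t^2, hence d = O(t) for all small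
    t. *)
Lemma descent (T : Type) (B : set T) (Phi : T -> R) (C t0 : R) :
  B !=set0 -> (forall y, 0 <= Phi y) -> 0 < t0 ->
  (forall t y, 0 < t -> t <= t0 -> B y ->
    exists2 y', B y' & Phi y' <= (1 - t / 2) * Phi y + C * t ^+ 2) ->
  forall e, 0 < e -> exists2 y, B y & Phi y < e.
Proof.
move=> [y0 By0] Phi0 t00 step e e0; apply: contrapT => nosmall.
pose I := [set Phi y | y in B].
have I0 : has_inf I by split; [exists (Phi y0), y0|exists 0 => _ [y _ <-]].
have infB y : B y -> inf I <= Phi y by move=> By; apply: ge_inf; [case: I0|exists y].
have einf : e <= inf I.
  apply: lb_le_inf; first by case: I0.
  by move=> _ [y By <-]; rewrite leNgt; apply/negP => ye; apply: nosmall; exists y.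
(* For this t the inequality inf <= 2 (C + 1) t contradicts e <= inf. *)
pose t := Num.min (Num.min t0 1) (e / (4 * (`|C| + 1))).
have C0 := normr_ge0 C; have CC := ler_norm C.
have t_gt0 : 0 < t by rewrite !lt_min t00 ltr01 divr_gt0//; lra.
have [tt0 t1 te] : [/\ t <= t0, t <= 1 & t <= e / (4 * (`|C| + 1))].
  by rewrite /t !ge_min !lexx !orbT.
have t20 : 0 < t ^+ 2 by rewrite exprn_gt0.
have [_ [y By <-] yt] := inf_adherent t20 I0.
have [y' By' y't] := step t y t_gt0 tt0 By.
have := infB _ By'.
have {}te : 4 * (`|C| + 1) * t <= e by rewrite -ler_pdivlMl// 1?mulrC//; lra.
move=> h1.
have h2 : (1 - t / 2) * Phi y <= (1 - t / 2) * (inf I + t ^+ 2).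
  by rewrite ler_wpM2l ?(ltW yt)//; lra.
have h3 : inf I * (t / 2) <= (C + 1) * t ^+ 2 by have := t20; nra.
have h4 : inf I / 2 <= (C + 1) * t.
  rewrite -(ler_pM2r t_gt0); rewrite expr2 in h3; lra.
have h5 : (C + 1) * t <= (`|C| + 1) * t by rewrite ler_pM2r//; lra.
lra.
Qed.

End Descent.

Section Goldstine.
Variables (R : realType) (X : normedModType R[i]).
Implicit Types (phi : dual X) (x y : X).

Definition rball (r : R) : set X := [set x | rnorm x < r].

Lemma rball_convex r x y (t : R) : 0 <= t <= 1 -> rball r x -> rball r y ->
  rball r (x + t%:C *: (y - x)).
Proof.
move=> /andP[t0 t1] xr yr; rewrite /rball/=.
have -> : x + t%:C *: (y - x) = (1 - t)%:C *: x + t%:C *: y.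
  by rewrite rmorphB /= scalerBl scale1r scalerBr addrA addrAC.
apply: le_lt_trans (rnormD _ _) _; rewrite !rnormZ !rnormR !ger0_norm ?subr_ge0//.
rewrite /rball/= in xr yr.
have [->|tn0] := eqVneq t 0; first by rewrite subr0 mul1r mul0r addr0.
have tgt : 0 < t by rewrite lt_neqAle eq_sym tn0.
have h1 : t * rnorm y < t * r by rewrite ltr_pM2l.
have h2 : (1 - t) * rnorm x <= (1 - t) * r by rewrite ler_wpM2l ?subr_ge0// ltW.
lra.
Qed.

(** Rotating y turns the bound on the real part into a bound on the modulus, so
    that the norm of psi is at most K / r. *)
Lemma Re_bidual_le (z : dual (dual X)) (r K : R) (psi : dual X) :
  0 < r -> rnorm z <= r ->
  (forall y, rball r y -> complex.Re (psi y) <= K) -> complex.Re (z psi) <= K.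
Proof.
move=> r0 zr psiK.
have psiK' y : rball r y -> rnorm (psi y) <= K.
  move=> yr; have [c c1 cy] := rotation (psi y).
  have := psiK (c *: y); rewrite /rball/= rnormZ c1 mul1r => /(_ yr).
  have -> : psi (c *: y) = c * psi y by rewrite linearZ.
  by rewrite cy.
have K0 : 0 <= K.
  by apply: le_trans (psiK' 0 _); rewrite ?rnorm_ge0// /rball/= rnorm0.
have psin : rnorm psi <= K / r.
  apply: rnorm_dual_le => [|x]; first by rewrite divr_ge0// ltW.
  apply/ler_addgt0Pr => e e0.
  have x0 := rnorm_ge0 x.
  pose s := rnorm x + e * r / (K + 1).
  have ss : rnorm x < s by rewrite ltrDl divr_gt0 ?mulr_gt0//; lra.
  have s0 : 0 < s := le_lt_trans x0 ss.
  have := psiK' ((r / s)%:C *: x).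
  have -> : psi ((r / s)%:C *: x) = (r / s)%:C * psi x by rewrite linearZ.
  rewrite /rball/= rnormM rnormZ rnormR ger0_norm; last by rewrite divr_ge0 ?ltW.
  have -> : r / s * rnorm x < r by rewrite mulrAC ltr_pdivrMr// ltr_pM2l.
  move=> /(_ isT); rewrite mulrAC ler_pdivrMr// mulrC -ler_pdivlMr// => h.
  apply: le_trans h _; rewrite mulrAC /s mulrDr lerD2l.
  rewrite [leLHS](_ : _ = e * (K / (K + 1))); last by field; lra.
  by rewrite ger_pMr// ler_pdivrMr; lra.
apply: le_trans (Re_le_rnorm _) _; apply: le_trans (le_rnorm_dual _ _) _.
apply: (@le_trans _ _ (r * (K / r))); last by rewrite mulrC divfK// gt_eqF.
by apply: ler_pM; rewrite ?rnorm_ge0.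
Qed.

Lemma ReMB (a b c : R[i]) :
  complex.Re (a * b) - complex.Re (a * c) = complex.Re (a * (b - c)).
Proof. by rewrite -ReN -ReD -mulrN -mulrDr. Qed.

Lemma rnorm_sqrB (w v : R[i]) (t : R) : rnorm (w - t%:C * v) ^+ 2 =
  rnorm w ^+ 2 - 2 * t * complex.Re (conjc w * v) + t ^+ 2 * rnorm v ^+ 2.
Proof. by rewrite !rnorm_sqr; case: w v => [a b] [c d] /=; ring. Qed.

(** With w phi = z phi - phi x and psi the combination of the phi with coefficients
    the conjugates of w phi, the derivative of the defect in the direction y - x
    is -2 Re psi(y - x). By [Re_bidual_le] some y of the ball has Re psi(y) almost
    as large as Re z(psi), and Re (z(psi) - psi(x)) is the defect at x. *)
Lemma goldstine (z : dual (dual X)) (r e : R) (L : seq (dual X)) :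
  0 < r -> rnorm z <= r -> 0 < e ->
  exists2 x, rball r x & forall phi, phi \in L -> rnorm (z phi - phi x) < e.
Proof.
move=> r0 zr e0.
pose Phi x := \sum_(phi <- L) rnorm (z phi - phi x) ^+ 2.
have Phi0 x : 0 <= Phi x by apply: sumr_ge0 => phi _; rewrite exprn_ge0// rnorm_ge0.
pose S := \sum_(phi <- L) (rnorm phi * (2 * r)) ^+ 2.
have [] := @descent R X (rball r) Phi (2 + S) 1 _ Phi0 _ _ (e ^+ 2); last first.
- move=> x xr xe; exists x => // phi phiL.
  rewrite -(@ltr_pXn2r _ 2)// ?nnegrE ?rnorm_ge0 ?(ltW e0)//.
  apply: le_lt_trans xe; rewrite /Phi (big_rem phi phiL)/= lerDl.
  by apply: sumr_ge0 => ? _; rewrite exprn_ge0// rnorm_ge0.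
- by rewrite exprn_gt0.
- move=> t x t0 t1 xr.
  pose w (phi : dual X) : R[i] := z phi - phi x.
  pose psi : dual X := \sum_(phi <- L) conjc (w phi) *: phi.
  have ReE (Z : dual (dual X)) :
      complex.Re (Z psi) = \sum_(phi <- L) complex.Re (conjc (w phi) * Z phi).
    rewrite /psi linear_sum /=.
    elim: L {Phi Phi0 S psi} => [|phi L ih]; first by rewrite !big_nil.
    by rewrite !big_cons ReD ih linearZ.
  have [y yr hy] : exists2 y, rball r y & complex.Re (z psi) - t < complex.Re (psi y).
    apply: contrapT => noy.
    suff : complex.Re (z psi) <= complex.Re (z psi) - t by lra.
    apply: (Re_bidual_le r0 zr) => y yr; rewrite leNgt; apply/negP => hy.
    by apply: noy; exists y.
  exists (x + t%:C *: (y - x)); first by apply: rball_convex => //; lra.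
  have PhiE : Phi x = complex.Re (z psi) - complex.Re (psi x).
    rewrite (ReE z) (ReE (bidual_embed x)) -sumrB; apply: eq_bigr => phi _.
    apply: etrans (esym (ReMB (conjc (w phi)) (z phi) (phi x))).
    by rewrite -/(w phi) rnorm_sqr; case: (w phi) => a b /=; ring.
  have -> : Phi (x + t%:C *: (y - x)) = Phi x - 2 * t * (complex.Re (psi y) - complex.Re (psi x)) +
      t ^+ 2 * \sum_(phi <- L) rnorm (phi y - phi x) ^+ 2.
    rewrite (ReE (bidual_embed x)) (ReE (bidual_embed y)) -sumrB !mulr_sumr -sumrB -big_split/=.
    apply: eq_bigr => phi _.
    have -> : z phi - phi (x + t%:C *: (y - x)) = w phi - t%:C * (phi y - phi x).
      by rewrite linearD linearZ /= linearB opprD addrA.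
    rewrite rnorm_sqrB; congr (_ - _ * _ + _).
    exact: esym (ReMB (conjc (w phi)) (phi y) (phi x)).
  have hS : \sum_(phi <- L) rnorm (phi y - phi x) ^+ 2 <= S.
    apply: ler_sum => phi _; rewrite lerXn2r ?nnegrE ?rnorm_ge0//.
      by rewrite !mulr_ge0 ?rnorm_ge0 ?(ltW r0).
    have -> : phi y - phi x = phi (y - x) by rewrite linearB.
    apply: le_trans (le_rnorm_dual _ _) _; rewrite ler_wpM2l ?rnorm_ge0//.
    by have := rnormB y x; rewrite /rball/= in xr yr; lra.
  have hS2 : t ^+ 2 * (\sum_(phi <- L) rnorm (phi y - phi x) ^+ 2) <= t ^+ 2 * S.
    by rewrite ler_wpM2l ?sqr_ge0.
  have h1 : t * (Phi x - t) <= t * (complex.Re (psi y) - complex.Re (psi x)).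
    by rewrite ler_pM2l// PhiE; lra.
  have h2 : 0 <= t * Phi x by rewrite mulr_ge0// ltW.
  rewrite expr2 in hS2 *; lra.
- by [].
- by exists 0; rewrite /rball/= rnorm0.
Qed.

End Goldstine.

(** * First-order expansion of a form along a segment *)

Section Expansion.
Variables (R : realType) (X : normedModType R[i]).
Implicit Types (F : seq X -> Cplx R) (x y : X) (s : seq X) (M r t : R).

Lemma symform_segment m M F x y t s : symform m M F -> (size s).+1 = m ->
  F ((y + t%:C *: (x - y)) :: s) = F (y :: s) + t%:C * (F (x :: s) - F (y :: s)).
Proof.
move=> FF sm; have lF := symform_linear FF sm.
have -> : y + t%:C *: (x - y) = t%:C *: (x - y) + y by rewrite addrC.
rewrite lF; have -> : x - y = -1 *: y + x by rewrite scaleN1r addrC.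
rewrite lF scaleN1r addrC; congr (_ + _).
rewrite -[LHS]/(t%:C * _); congr (_ * _); exact: addrC.
Qed.

Lemma symform_nseq_le m M F r s : symform m M F -> size s = m -> 0 <= M ->
  (forall x, x \in s -> rball r x) -> rnorm (F s) <= M * r ^+ m.
Proof.
move=> FF sm M0 sr; apply: le_trans (symform_bound FF sm) _; rewrite ler_wpM2l//.
elim: s {FF} m sm sr => [|x s ih] m /= <- sr; first by rewrite big_nil expr0.
rewrite big_cons exprS; apply: ler_pM; rewrite ?rnorm_ge0 ?prod_rnorm_ge0//.
  by apply: ltW; apply: sr; rewrite mem_head.
by apply: ih => // u us; apply: sr; rewrite inE us orbT.
Qed.

(** Induction on the arity: the difference is split in the first variable, and
    symmetry moves the increments of the other variables to the front. *)
Lemma symform_expand k r : 0 < r -> exists L C : R, [/\ 0 <= L, 0 <= C &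
  forall M F x y t, 0 <= M -> symform k M F -> 0 <= t -> t <= 1 ->
    rball r x -> rball r y ->
    rnorm (F (nseq k (y + t%:C *: (x - y))) - F (nseq k y)) <= L * M * t /\
    rnorm (F (nseq k (y + t%:C *: (x - y))) - F (nseq k y) -
      k%:R * (t%:C * (F (x :: nseq k.-1 y) - F (nseq k y)))) <= C * M * t ^+ 2].
Proof.
move=> r0; elim: k => [|k [L [C [L0 C0 ih]]]].
  exists 0, 0; split=> // M F x y t M0 _ t0 t1 _ _ /=.
  by rewrite subrr !mul0r subr0 rnorm0.
exists (L * r + 2 * r ^+ k.+1), (C * r + 2 * (L * r)).
have Lr : 0 <= L * r by rewrite mulr_ge0// ltW.
have Cr : 0 <= C * r by rewrite mulr_ge0// ltW.
have rk : 0 <= r ^+ k.+1 by rewrite exprn_ge0// ltW.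
split; [lra|lra|move=> M F x y t M0 FF t0 t1 xr yr].
have mem_ball (v : X) n : rball r v -> forall u, u \in nseq n v -> rball r u.
  by move=> vr u /nseqP[->].
set v := y + _ *: _.
have vr : rball r v by apply: rball_convex => //; rewrite t0 t1.
have Mu (u : X) : 0 <= M * rnorm u by rewrite mulr_ge0 ?rnorm_ge0.
have Mur (u : X) : rball r u -> M * rnorm u <= M * r by move=> ur; rewrite ler_wpM2l// ltW.
have Fv : F (nseq k.+1 v) = F (y :: nseq k v) + t%:C * (F (x :: nseq k v) - F (y :: nseq k v)).
  by rewrite /= (symform_segment _ _ _ FF)//= size_nseq.
have nF u : rball r u -> rnorm (F (u :: nseq k v)) <= M * r ^+ k.+1.
  move=> ur; apply: (symform_nseq_le FF) => //=; first by rewrite size_nseq.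
  by move=> w; rewrite inE => /predU1P[->//|]; exact: mem_ball.
have lip u : rball r u -> rnorm (F (u :: nseq k v) - F (u :: nseq k y)) <= L * r * M * t.
  move=> ur; have [h _] := ih _ _ x y t (Mu u) (symform_cons u FF) t0 t1 xr yr.
  apply: le_trans h _; rewrite ler_wpM2r// -!mulrA ler_wpM2l// (mulrC r) ?Mur//.
have nt : rnorm (t%:C : R[i]) = t by rewrite rnormR ger0_norm.
split.
  have -> : F (nseq k.+1 v) - F (nseq k.+1 y) = (F (y :: nseq k v) - F (y :: nseq k y)) +
     t%:C * (F (x :: nseq k v) - F (y :: nseq k v)) by rewrite Fv /= addrAC.
  apply: le_trans (rnormD _ _) _; apply: le_trans (lerD (lip _ yr) (lexx _)) _.
  rewrite rnormM nt.
  have := le_trans (rnormB _ _) (lerD (nF _ xr) (nF _ yr)).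
  move=> /(ler_wpM2l t0); lra.
have [_ h] := ih _ _ x y t (Mu y) (symform_cons y FF) t0 t1 xr yr.
have -> : F (nseq k.+1 v) - F (nseq k.+1 y) -
   k.+1%:R * (t%:C * (F (x :: nseq k y) - F (nseq k.+1 y))) =
   (F (y :: nseq k v) - F (y :: nseq k y) -
      k%:R * (t%:C * (F [:: y, x & nseq k.-1 y] - F (y :: nseq k y)))) +
   t%:C * ((F (x :: nseq k v) - F (x :: nseq k y)) - (F (y :: nseq k v) - F (y :: nseq k y))).
  have -> : k%:R * (t%:C * (F [:: y, x & nseq k.-1 y] - F (y :: nseq k y))) =
            k%:R * (t%:C * (F (x :: nseq k y) - F (y :: nseq k y))) :> R[i].
    case: (k) FF => [|k'] FF; first by rewrite !mul0r.
    congr (_ * (_ * (_ - _))); apply: (symform_perm FF); first by rewrite /= size_nseq.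
    by apply/seq.permP => P /=; rewrite addnCA.
  rewrite Fv /= -addn1 natrD.
  move: (F _) (F _) (F _) (F _) => A1 A2 A3 A4; ring.
apply: le_trans (rnormD _ _) _.
have hy : C * (M * rnorm y) * t ^+ 2 <= C * r * M * t ^+ 2.
  by rewrite ler_wpM2r ?exprn_ge0// -mulrA ler_wpM2l// (mulrC r) Mur.
have := le_trans (rnormB _ _) (lerD (lip _ xr) (lip _ yr)).
move=> /(ler_wpM2l t0) h3.
rewrite rnormM nt.
apply: le_trans (lerD (le_trans h hy) h3) _.
by rewrite expr2; lra.
Qed.

End Expansion.

Section WeightedSum.
Variable R : realType.

(** With w_k = 4^-k one has k w_k - (k+1) w_(k+1) >= w_k / 2, so the mass moved
    from each term to the next one is dominated by the mass it loses. *)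
Lemma weighted_descent m (e e' : nat -> R) (t D : R) :
  e 0%N = 0 -> e' 0%N = 0 -> (forall k, 0 <= e k) -> 0 <= t -> 0 <= D ->
  (forall k, (k < m)%N ->
    e' k.+1 <= (1 - k.+1%:R * t) * e k.+1 + k.+1%:R * t * e k + D) ->
  \sum_(k < m.+1) e' k / 4 ^+ k <=
    (1 - t / 2) * (\sum_(k < m.+1) e k / 4 ^+ k) + m%:R * D.
Proof.
move=> e0 e'0 epos t0 D0 h.
have p4 k : (0 : R) < (4 ^+ k)^-1 by rewrite invr_gt0 exprn_gt0.
suff : \sum_(k < m.+1) e' k / 4 ^+ k + m.+1%:R * t * e m / 4 ^+ m.+1 <=
    (1 - t / 2) * (\sum_(k < m.+1) e k / 4 ^+ k) + m%:R * D.
  apply: le_trans; rewrite lerDl !mulr_ge0 ?ler0n//; exact: ltW.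
elim: m h => [|m ih] h.
  by rewrite !big_ord1 e'0 e0 !(mul0r, mulr0) addr0.
rewrite big_ord_recr [in leRHS]big_ord_recr /=.
have {ih} := ih (fun k km => h k (ltnW km)).
have hm := h m (ltnSn m).
have h1 := ler_wpM2r (ltW (p4 m.+1)) hm.
have h2 : D / 4 ^+ m.+1 <= D.
  by rewrite ler_pdivrMr ?exprn_gt0// ler_peMr// exprn_ege1// ler1n.
have h3 : 0 <= e m.+1 * t / 4 ^+ m.+1 by rewrite !mulr_ge0// ltW.
have h4 : 0 <= m%:R * (e m.+1 * t / 4 ^+ m.+1) by rewrite mulr_ge0 ?ler0n.
rewrite [4 ^+ m.+2]exprS invfM -(@natr1 _ m.+1) -(@natr1 _ m).
rewrite -(@natr1 _ m) in h1.
move: h1 h2 h3 h4; move: (p4 m.+1).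
set q := (4 ^+ m.+1)^-1; move: q => q q0.
move: (\sum_(i < m.+1) _) (\sum_(i < m.+1) _) => S1 S2.
move: (e m) (e m.+1) (e' m.+1) (m%:R) => a b c n.
move=> h1 h2 h3 h4 h5.
lra.
Qed.

End WeightedSum.

(** * The Davie--Gamelin theorem *)

Section DavieGamelin.
Variables (R : realType) (X : normedModType R[i]).
Variables (z : dual (dual X)) (r : R).
Hypotheses (r0 : 0 < r) (zr : rnorm z <= r).
Implicit Types (F : seq X -> Cplx R) (x y : X) (Phi : X -> R).

(** The defect Phi decreases towards x as soon as x is close to z on finitely many
    functionals, which may depend on y and t. In this form the property passes to
    finite sums. *)
Definition descends Phi := exists C t0 : R, 0 < t0 /\
  forall t y, 0 < t -> t <= t0 -> rball r y -> exists L : seq (dual X),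
    forall x, rball r x -> (forall phi, phi \in L -> rnorm (z phi - phi x) < t) ->
      Phi (y + t%:C *: (x - y)) <= (1 - t / 2) * Phi y + C * t ^+ 2.

Lemma descends0 : descends (fun=> 0).
Proof.
exists 0, 1; split=> // t y t0 t1 yr; exists [::] => x _ _.
by rewrite mulr0 mul0r addr0.
Qed.

Lemma descendsD Phi1 Phi2 : descends Phi1 -> descends Phi2 ->
  descends (fun x => Phi1 x + Phi2 x).
Proof.
move=> [C1 [t1 [t10 h1]]] [C2 [t2 [t20 h2]]].
exists (C1 + C2), (Num.min t1 t2); split; first by rewrite lt_min t10.
move=> t y t0; rewrite le_min => /andP[tt1 tt2] yr.
have [L1 hL1] := h1 t y t0 tt1 yr; have [L2 hL2] := h2 t y t0 tt2 yr.
exists (L1 ++ L2) => x xr xL.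
have xL1 := hL1 x xr (fun phi h => xL phi (etrans (mem_cat phi L1 L2) (introT orP (or_introl h)))).
have xL2 := hL2 x xr (fun phi h => xL phi (etrans (mem_cat phi L1 L2) (introT orP (or_intror h)))).
lra.
Qed.

Lemma descendsZ (a : R) Phi : 0 <= a -> descends Phi ->
  descends (fun x => a * Phi x).
Proof.
move=> a0 [C [t1 [t10 h]]]; exists (a * C), t1; split=> // t y t0 tt1 yr.
have [L hL] := h t y t0 tt1 yr; exists L => x xr xL.
have := ler_wpM2l a0 (hL x xr xL); lra.
Qed.

Lemma descends_small Phi (e : R) : (forall x, 0 <= Phi x) -> descends Phi ->
  0 < e -> exists2 x, rball r x & Phi x < e.
Proof.
move=> Phi0 [C [t0 [t00 h]]].
apply: (@descent R X (rball r) Phi C (Num.min t0 1)) => //.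
- by exists 0; rewrite /rball/= rnorm0.
- by rewrite lt_min t00 ltr01.
move=> t y tgt; rewrite le_min => /andP[tt0 t1] yr.
have [L hL] := h t y tgt tt0 yr.
have [x xr xL] := goldstine L r0 zr tgt.
(* The step goes towards a point x provided by Goldstine's theorem. *)
exists (y + t%:C *: (x - y)); last exact: hL.
by apply: rball_convex => //; rewrite (ltW tgt).
Qed.

Lemma telescope_step (A B U W a n T : R[i]) : A - a =
  (A - B - n * (T * (W - B))) + (1 - n * T) * (B - a) + n * T * (U - a) + n * T * (W - U).
Proof. ring. Qed.

(** Here u k y is A(y^k, z^(m-k)) and e k y its distance to A(z^m). The factor
    4^m makes the weight of the last term k = m equal to 1, and this term is the modulus of
    A(z^m) - A(y^m). *)
Lemma descends_symform m M F : 0 <= M -> symform m M F ->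
  exists Phi : X -> R, descends Phi /\
    forall x, 0 <= Phi x /\ rnorm (abval z m F - F (nseq m x)) <= Phi x.
Proof.
move=> M0 FF.
pose u k y := partval z (m - k) F (nseq k y).
pose e k y := rnorm (u k y - abval z m F).
have Gk k : (k <= m)%N -> symform k (M * rnorm z ^+ (m - k)) (partval z (m - k) F).
  by move=> km; apply: symform_partval => //; rewrite subnKC.
have e_ge0 k y : 0 <= e k y by exact: rnorm_ge0.
pose Psi y := \sum_(k < m.+1) e k y / 4 ^+ k.
exists (fun y => 4 ^+ m * Psi y); split; last first.
  move=> x; have ge0 (k : 'I_m.+1) : 0 <= e k x / 4 ^+ k by rewrite divr_ge0// exprn_ge0.
  split; first by rewrite mulr_ge0 ?exprn_ge0// sumr_ge0.
  rewrite /Psi (bigD1 ord_max)//= mulrDr mulrC divfK ?expf_neq0 ?pnatr_eq0//.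
  rewrite {1}/e /u subnn partval0 rnorm_distC lerDl.
  by rewrite mulr_ge0 ?exprn_ge0 ?sumr_ge0.
apply: (@descendsZ (4 ^+ m) Psi); first by rewrite exprn_ge0.
have /choice[C hC] (k : nat) : exists C, 0 <= C /\ forall M F x y t, 0 <= M ->
    symform k M F -> 0 <= t -> t <= 1 -> rball r x -> rball r y ->
    rnorm (F (nseq k (y + t%:C *: (x - y))) - F (nseq k y) -
      k%:R * (t%:C * (F (x :: nseq k.-1 y) - F (nseq k y)))) <= C * M * t ^+ 2.
  have [? [C [? C0 h]]] := symform_expand X k r0; exists C; split=> //.
  by move=> M' F' x y t h1 h2 h3 h4 h5 h6; exact: (h M' F' x y t h1 h2 h3 h4 h5 h6).2.
pose c k := C k * (M * rnorm z ^+ (m - k)).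
have c0 k : 0 <= c k by rewrite /c !mulr_ge0 ?exprn_ge0 ?rnorm_ge0//; case: (hC k).
pose D := \sum_(k < m) c k.+1 + m%:R.
have D0 : 0 <= D by rewrite addr_ge0 ?ler0n// sumr_ge0.
have t00 : 0 < (m.+1%:R : R)^-1 by rewrite invr_gt0 ltr0n.
exists (m%:R * D), m.+1%:R^-1; split=> // t y t0 tm yr.
have t1 : t <= 1 by apply: le_trans tm _; rewrite invf_le1 ?ltr0n// ler1n.
exists [seq dualize (fun x => partval z (m - k.+1) F (rcons (nseq k y) x)) | k <- iota 0 m].
move=> x xr xL; rewrite -mulrA.
have e00 v : e 0%N v = 0 by rewrite /e /u subn0 /partval /= subrr rnorm0.
apply: (@weighted_descent _ m (e ^~ y) (e ^~ (y + t%:C *: (x - y)))) => //.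
- exact: ltW.
- by rewrite mulr_ge0// exprn_ge0// ltW.
move=> k km.
have rconsE : (fun x => partval z (m - k.+1) F (rcons (nseq k y) x)) =
    (fun x => partval z (m - k.+1) F (x :: nseq k y)).
  apply/funext => v; apply: (symform_perm (Gk _ km)).
    by rewrite size_rcons size_nseq.
  by rewrite perm_rcons.
have zk : z (dualize (fun x => partval z (m - k.+1) F (x :: nseq k y))) = u k y.
  by rewrite -rconsE /u -partvalS subnSK.
have M'0 : 0 <= M * rnorm z ^+ (m - k.+1) by rewrite mulr_ge0 ?exprn_ge0 ?rnorm_ge0.
have kL : rnorm (u k y - partval z (m - k.+1) F (x :: nseq k y)) < t.
  have dk := congr1 (@^~ x) (dualizeE (symform_head_dual (Gk _ km) (size_nseq k y))).
  have := xL (dualize (fun x => partval z (m - k.+1) F (x :: nseq k y))).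
  rewrite zk -dk; apply; apply/mapP; exists k; first by rewrite mem_iota.
  by rewrite rconsE.
have [_ hCk] := hC k.+1.
have := hCk _ _ x y t M'0 (Gk _ km) (ltW t0) t1 xr yr.
rewrite -/(c k.+1) -/(u k.+1 y) -/(u k.+1 (y + t%:C *: (x - y))) -[_.+1.-1]/k /e.
move: kL; set A := u k.+1 _; set B := u k.+1 y; set U := u k y.
set W := partval _ _ _ _; set a0 := abval _ _ _ => kL hA.
have -> : A - a0 = (A - B - k.+1%:R * (t%:C * (W - B))) +
   (1 - k.+1%:R * t)%:C * (B - a0) + (k.+1%:R * t)%:C * (U - a0) + (k.+1%:R * t)%:C * (W - U).
  have -> : (1 - k.+1%:R * t)%:C = 1 - (k.+1%:R * t)%:C :> R[i] by rewrite rmorphB rmorph1.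
  have -> : (k.+1%:R * t)%:C = k.+1%:R * t%:C :> R[i] by rewrite rmorphM /= rmorph_nat.
  exact: telescope_step.
have kt : k.+1%:R * t <= 1.
  have : m.+1%:R * t <= 1 by rewrite -ler_pdivlMl ?ltr0n// mulr1.
  by apply: le_trans; rewrite ler_wpM2r ?(ltW t0)// ler_nat ltnW.
have kt0 : 0 <= k.+1%:R * t by rewrite mulr_ge0 ?ler0n// ltW.
have cD : c k.+1 + k.+1%:R <= D.
  rewrite /D lerD ?ler_nat// (bigD1 (Ordinal km))//= lerDl.
  exact: sumr_ge0.
have := ler_wpM2r (sqr_ge0 t) cD; rewrite mulrDl => h1.
apply: le_trans (rnormD _ _) _; apply: le_trans (lerD (rnormD _ _) (lexx _)) _.
apply: le_trans (lerD (lerD (rnormD _ _) (lexx _)) (lexx _)) _.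
rewrite (rnormM (_%:C) (B - a0)) (rnormM (_%:C) (U - a0)) (rnormM (_%:C) (W - U)).
rewrite !rnormR (ger0_norm kt0) ger0_norm ?subr_ge0// (rnorm_distC W).
have h2 := ler_wpM2l kt0 (ltW kL).
have -> : D * t ^+ 2 = D * t * t by rewrite expr2 mulrA.
rewrite expr2 in hA h1; lra.
Qed.

(** Finitely many forms are treated at once by summing their defects. *)
Lemma davie_gamelin (I : Type) (m : I -> nat) (M : I -> R)
    (F : I -> seq X -> Cplx R) (s : seq I) (e : R) :
  (forall i, 0 <= M i) -> (forall i, symform (m i) (M i) (F i)) -> 0 < e ->
  exists2 x, rball r x & forall i, List.In i s ->
    rnorm (abval z (m i) (F i) - F i (nseq (m i) x)) < e.
Proof.
move=> M0 FF e0.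
suff [Phi [dPhi hPhi]] : exists Phi, descends Phi /\ forall x, 0 <= Phi x /\
    forall i, List.In i s -> rnorm (abval z (m i) (F i) - F i (nseq (m i) x)) <= Phi x.
  have [x xr xe] := descends_small (fun x => proj1 (hPhi x)) dPhi e0.
  by exists x => // i si; apply: le_lt_trans xe; have [_] := hPhi x; apply.
elim: s => [|i s [Phi [dPhi hPhi]]].
  by exists (fun=> 0); split=> //; exact: descends0.
have [Psi [dPsi hPsi]] := descends_symform (M0 i) (FF i).
exists (fun x => Psi x + Phi x); split; first exact: descendsD.
move=> x; have [Phi0 xPhi] := hPhi x; have [Psi0 xPsi] := hPsi x.
split; first exact: addr_ge0.
move=> j [<-|/xPhi h]; first by apply: le_trans xPsi _; rewrite lerDl.
by apply: le_trans h _; rewrite lerDr.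
Qed.

End DavieGamelin.

(** * Forms on tuples and forms on sequences *)

Section PointwiseTopology.

Lemma cvg_initial (S : choiceType) (T : topologicalType) (f : S -> T)
    (F : set_system S) (s : S) : Filter F ->
  F --> (s : initial_topology f) <-> f @ F --> f s.
Proof.
move=> FF; split=> [Fs|fFs].
  exact: (cvg_comp _ _ Fs (@initial_continuous S T f s)).
move=> A /= [_ [[B Bop <-] Bfs sBfA]]; apply: filterS sBfA _.
by apply: fFs; exact: open_nbhs_nbhs.
Qed.

Lemma cvg_ptws (U : Type) (V : topologicalType) (F : set_system (U -> V))
    (g : U -> V) : Filter F ->
  F --> (g : {ptws U -> V}) <-> forall u, (fun h => h u) @ F --> g u.
Proof.
move=> FF; split=> [/cvg_sup h u|h].
  by have /cvg_initial := h u.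
by apply/cvg_sup => u; apply/cvg_initial; exact: h.
Qed.

End PointwiseTopology.

Section Forms.
Variables (R : realType) (X : normedModType R[i]).
Implicit Types (F : seq X -> Cplx R) (s : seq X) (x y : X) (M : R).

Definition seq_form m (A : ('I_m -> X) -> Cplx R) s : Cplx R :=
  A (fun i : 'I_m => nth 0 s i).

Definition fun_form m F (v : 'I_m -> X) : Cplx R := F [seq v i | i <- enum 'I_m].

Lemma fun_formE m (A : ('I_m -> X) -> Cplx R) : fun_form (seq_form A) = A.
Proof.
apply/funext => v; rewrite /fun_form /seq_form; congr A; apply/funext => i.
by rewrite (nth_map i) ?nth_ord_enum// size_enum_ord.
Qed.

Lemma fun_form_cst m F x : fun_form F (fun _ : 'I_m => x) = F (nseq m x).
Proof.
rewrite /fun_form; congr F; rewrite -[RHS](congr1 (nseq^~ x) (size_enum_ord m)).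
by elim: (enum 'I_m) => //= i s ->.
Qed.

Lemma linear_scale_bound (g : X -> Cplx R) (d B : R) : 0 < d -> linear g ->
  (forall x, rnorm x < d -> rnorm (g x) <= B) ->
  forall x, rnorm (g x) <= B * (2 / d) * rnorm x.
Proof.
move=> d0 lg gB x.
have g0 : g 0 = 0.
  by have := lg (-1) 0 0; rewrite !scaleN1r !addNr.
have gZ a y : g (a *: y) = a * g y by have := lg a y 0; rewrite !addr0 g0 addr0.
have [->|x0] := eqVneq x 0; first by rewrite g0 !rnorm0 mulr0.
have nx : 0 < rnorm x.
  by rewrite lt_neqAle rnorm_ge0 andbT eq_sym; apply: contra_neq x0 => /rnorm_eq0.
have c0 : 0 < d / 2 / rnorm x by rewrite !divr_gt0.
have := gB ((d / 2 / rnorm x)%:C *: x).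
rewrite rnormZ gZ rnormM rnormR (gtr0_norm c0) divfK ?gt_eqF// => h.
have {}h : d / 2 / rnorm x * rnorm (g x) <= B.
  apply: h.
  by rewrite ltr_pdivrMr// ltr_pMr// ltr1n.
move: h; rewrite -ler_pdivlMl// => h; apply: le_trans h _.
by rewrite !invf_div [X in X <= _](_ : _ = B * (2 / d) * rnorm x)//; ring.
Qed.

(** The variables are released one at a time: a functional bounded by B on the ball
    of radius d is bounded by B (2/d) |x| at each x. *)
Lemma local_bound_symform m F (d B : R) : 0 < d -> head_linear m F ->
  perm_invariant m F ->
  (forall s, size s = m -> (forall x, x \in s -> rnorm x < d) -> rnorm (F s) <= B) ->
  symform m (B * (2 / d) ^+ m) F.
Proof.
move=> d0 lF pF FB; split=> //; elim: m F B lF pF FB => [|m ih] F B lF pF FB.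
  by case=> // _; rewrite big_nil expr0 !mulr1; exact: FB.
case=> // x s [sm]; have [lFx pFx] := symlinear_cons x lF pF.
have := ih _ (B * (2 / d) * rnorm x) lFx pFx _ s sm.
rewrite big_cons exprS mulrA.
have -> : B * (2 / d) * rnorm x * (2 / d) ^+ m * \prod_(j <- s) rnorm j =
   B * ((2 / d) * (2 / d) ^+ m) * rnorm x * \prod_(j <- s) rnorm j by ring.
apply=> t tm td; apply: (linear_scale_bound d0 (lF t _)); first by rewrite tm.
move=> y yd; apply: FB; first by rewrite /= tm.
by move=> u; rewrite inE => /predU1P[->//|]; exact: td.
Qed.

(** Continuity at 0 for the product topology gives a bound on a box, because the
    filter of boxes converges to 0. *)
Lemma assoc_form_symform m (P : X -> Cplx R) A : @assoc_form R X m P A ->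
  exists M, [/\ 0 <= M, symform m M (seq_form A) &
    forall x, P x = seq_form A (nseq m x)].
Proof.
move=> [mA cA sA PA].
have lA : head_linear m (seq_form A).
  case: m A mA {cA sA PA} => // m A mA s [sm] a x y.
  have hd u : seq_form A (u :: s) =
      A (@dfwith _ (fun=> X) (fun i : 'I_m.+1 => nth 0 (0 :: s) i) (@ord0 m) u).
    rewrite /seq_form; congr A; apply/funext => i.
    have [->|i0] := eqVneq i ord0; first by rewrite dfwithin.
    rewrite dfwithout 1?eq_sym//; case: i i0 => -[|i] //.
  by rewrite !hd; exact: mA.
have pA : perm_invariant m (seq_form A).
  move=> s t sm st; have tm : size t == m by rewrite -(perm_size st) sm.
  have /tuple_permP[p sE] : perm_eq s (Tuple tm) by [].
  rewrite -[RHS](sA p); congr A; apply/funext => i /=.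
  by rewrite sE (nth_map i) ?size_enum_ord// nth_ord_enum (tnth_nth 0).
pose G : set_system ('I_m -> X) := filter_from [set e : R | 0 < e]
  (fun e => [set v | forall i, rnorm (v i) < e]).
have FG : Filter G.
  apply: filter_from_filter; first by exists 1; rewrite /= ltr01.
  move=> e e' e0 e'0; exists (Num.min e e'); first by rewrite /= lt_min e0.
  by move=> v /= ve; split=> i; have := ve i; rewrite lt_min => /andP[].
have G0 : G --> ((fun=> 0) : {ptws 'I_m -> X}).
  apply/cvg_ptws => i; apply/cvg_rnormP => e e0; exists e => // v /(_ i).
  by rewrite /= sub0r rnormN.
have AG : A @ G --> A (fun=> 0) by move=> U UA; exact: (G0 _ (cA _ U UA)).
have /cvg_rnormP/(_ 1 ltr01)[d d0 dA] := AG.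
pose B := rnorm (A (fun=> 0)) + 1.
have B0 : 0 <= B by rewrite addr_ge0 ?rnorm_ge0.
exists (B * (2 / d) ^+ m); split.
- by rewrite mulr_ge0 ?exprn_ge0// divr_ge0// ltW.
- apply: local_bound_symform => // s sm sd.
  have := dA (fun i => nth 0 s i); rewrite /= => /(_ _)h.
  have {}h : rnorm (A (fun=> 0) - seq_form A s) < 1.
    by apply: h => i; apply: sd; rewrite mem_nth// sm.
  have := rnormB (A (fun=> 0)) (A (fun=> 0) - seq_form A s).
  by rewrite opprB addrC subrK /B; lra.
- move=> x; rewrite PA /seq_form; congr A; apply/funext => i.
  by rewrite nth_nseq ltn_ord.
Qed.

(** The head variable is replaced first, at a cost proportional to the product of the
    norms of the other ones, which stays bounded along G. *)
Lemma cvg_symform m M F (T : Type) (G : set_system T) (ws : seq (T -> X)) (vs : seq X) :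
  Filter G -> 0 <= M -> symform m M F -> size ws = m -> size vs = m ->
  (forall i, (i < m)%N -> nth (fun=> 0) ws i @ G --> nth 0 vs i) ->
  (fun t : T => F [seq w t | w <- ws]) @ G --> F vs.
Proof.
move=> FG; elim: m M F ws vs => [|m ih] M F ws vs M0 FF.
  by move=> /size0nil -> /size0nil -> _; exact: cvg_cst.
case: ws => // w ws [wsm]; case: vs => // v vs [vsm] hw.
have Mv : 0 <= M * rnorm v by rewrite mulr_ge0 ?rnorm_ge0.
have /cvg_rnormP ih1 := ih _ _ ws vs Mv (symform_cons v FF) wsm vsm (fun i im => hw i.+1 im).
pose B := M * \prod_(u <- vs) (rnorm u + 1).
have B0 : 0 <= B.
  by rewrite mulr_ge0// prodr_ge0// => u _; rewrite addr_ge0 ?rnorm_ge0.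
have bd : \forall t \near G, M * \prod_(u <- [seq w t | w <- ws]) rnorm u <= B.
  suff h : \forall t \near G,
      \prod_(u <- [seq w t | w <- ws]) rnorm u <= \prod_(u <- vs) (rnorm u + 1).
    by apply: filterS h => u h; rewrite ler_wpM2l.
  have {}hw := fun i (im : (i < m)%N) => hw i.+1 im.
  elim: ws vs m {ih FF ih1 B B0} wsm vsm hw => [|w' ws ih] [|v' vs] [|m] //=.
    by move=> _ _ _; apply: filterE => t; rewrite !big_nil.
  move=> [wsm] [vsm] hw.
  have := ih vs m wsm vsm (fun i im => hw i.+1 im).
  have /cvg_rnormP/(_ 1 ltr01) := hw 0%N isT.
  apply: filterS2 => t /= h1 h2; rewrite !big_cons.
  apply: ler_pM; rewrite ?rnorm_ge0 ?prod_rnorm_ge0//.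
  by have := rnormB v' (v' - w' t); rewrite opprB addrC subrK; lra.
apply/cvg_rnormP => e e0.
have e20 : 0 < e / 2 by rewrite divr_gt0.
have /cvg_rnormP/(_ (e / 2 / (B + 1))) := hw 0%N isT.
rewrite !divr_gt0//; last lra; move=> /(_ isT).
have := ih1 _ e20; move: bd; apply: filterS3 => t /= h1 h2 h3.
apply: le_lt_trans (rnorm_distD (F (v :: [seq w t | w <- ws])) _ _) _.
have sz : (size [seq w t | w <- ws]).+1 = m.+1 by rewrite size_map wsm.
have -> : F (v :: [seq w t | w <- ws]) - F (w t :: [seq w t | w <- ws]) =
   F (v - w t :: [seq w t | w <- ws]).
  have := symform_linear FF sz (-1) (w t) v; rewrite !scaleN1r.
  by rewrite [- w t + v]addrC [- F _ + _]addrC.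
rewrite (splitr e); apply: ltrD; first exact: h2.
have h4 := symform_bound FF (s := v - w t :: [seq w t | w <- ws]) sz.
apply: le_lt_trans h4 _; rewrite big_cons mulrCA mulrC.
rewrite ltr_pdivlMr in h3; last lra.
apply: le_lt_trans h3; rewrite mulrC; apply: ler_wpM2l; [exact: rnorm_ge0|lra].
Qed.

(** Slot i is moved to the head by symmetry, and continuity for the product
    topology is [cvg_symform] for the coordinate functions. *)
Lemma symform_assoc_form m M F (P : X -> Cplx R) : 0 <= M -> symform m M F ->
  (forall x, P x = F (nseq m x)) -> @assoc_form R X m P (@fun_form m F).
Proof.
move=> M0 FF PF; split.
- move=> v i a x y; rewrite /fun_form.
  have hd u : F [seq @dfwith _ (fun=> X) v i u j | j <- enum 'I_m] =
      F (u :: [seq v j | j <- rem i (enum 'I_m)]).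
    apply: (symform_perm FF); first by rewrite size_map size_enum_ord.
    have := perm_to_rem (mem_enum 'I_m i) => /(perm_map (@dfwith _ (fun=> X) v i u)).
    move=> /perm_trans; apply; rewrite /= dfwithin perm_cons.
    have -> // : [seq @dfwith _ (fun=> X) v i u j | j <- rem i (enum 'I_m)] =
        [seq v j | j <- rem i (enum 'I_m)].
    apply/eq_in_map => j.
    by rewrite (mem_rem_uniq _ (enum_uniq _)) inE => /andP[ji _]; rewrite dfwithout// eq_sym.
  rewrite !hd (symform_linear FF)// size_map size_rem ?mem_enum// size_enum_ord.
  by rewrite prednK// (leq_ltn_trans _ (ltn_ord i)).
- move=> v; rewrite /continuous_at /fun_form.
  have -> : (fun v : 'I_m -> X => F [seq v i | i <- enum 'I_m]) =
      (fun v' : 'I_m -> X => F [seq w v' | w <- [seq (fun v : 'I_m -> X => v i) | i <- enum 'I_m]]).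
    by apply/funext => u; rewrite -map_comp.
  apply: (@cvg_symform m M F _ (nbhs (v : {ptws 'I_m -> X}))) => //.
  + by rewrite size_map size_enum_ord.
  + by rewrite size_map size_enum_ord.
  + move=> i im; have im' : (i < size (enum 'I_m))%N by rewrite size_enum_ord.
    rewrite (nth_map (Ordinal im) _ _ im') (nth_map (Ordinal im) _ _ im').
    have FV : Filter (nbhs (v : {ptws 'I_m -> X})) by exact: nbhs_filter.
    have h0 := @cvg_ptws 'I_m X (nbhs (v : {ptws 'I_m -> X})) v FV.
    have h := h0.1 (fun A vA => vA).
    exact: h.
- move=> p v; rewrite /fun_form; apply: (symform_perm FF).
    by rewrite size_map size_enum_ord.
  have -> : [seq (v \o p) i | i <- enum 'I_m] = [seq v i | i <- [seq p i | i <- enum 'I_m]].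
    exact: (map_comp v p (enum 'I_m)).
  apply: perm_map; apply: uniq_perm; rewrite ?enum_uniq//.
    by rewrite map_inj_uniq ?enum_uniq//; exact: perm_inj.
  move=> i; rewrite mem_enum; apply/mapP; exists (perm_inv p i); rewrite ?mem_enum//.
  by rewrite permKV.
- by move=> x; rewrite fun_form_cst.
Qed.

Lemma homog_polyP m (P : X -> Cplx R) : homog_poly m P <->
  exists M F, [/\ 0 <= M, symform m M F & forall x, P x = F (nseq m x)].
Proof.
split=> [[A /assoc_form_symform[M [M0 FA PA]]]|[M [F [M0 FF PF]]]].
  by exists M, (seq_form A).
by exists (@fun_form m F); exact: (symform_assoc_form M0 FF PF).
Qed.

End Forms.

(** * Nets and extensions of polynomials *)

Section Nets.

Lemma tails_proper (D : directed) : ProperFilter (@tails D).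
Proof.
have [d0] := dir_inhabited D.
apply: Build_ProperFilter.
  by move=> [a /(_ a (dir_refl a))].
split.
- by exists d0.
- move=> A B [a Aa] [b Bb]; have [c [ac bc]] := dir_bound a b; exists c => d cd.
  by split; [apply: Aa; exact: dir_trans ac cd|apply: Bb; exact: dir_trans bc cd].
- by move=> A B AB [a Aa]; exists a => b /Aa /AB.
Qed.

Lemma net_lim_proper (T : Type) (x : net T) : ProperFilter (net_lim x).
Proof. by have := tails_proper (net_dom x); exact: fmap_proper_filter. Qed.

Lemma net_lim_all (T : Type) (x : net T) (B : set T) :
  (forall a, B (x a)) -> net_lim x B.
Proof.
by move=> xB; have [d] := dir_inhabited (net_dom x); exists d => b _; exact: xB.
Qed.

Lemma positive_lower_bound (R : realType) (I : Type) (c : I -> R) (s : seq I) :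
  (forall i, 0 < c i) -> exists2 e : R, 0 < e & forall i, List.In i s -> e <= c i.
Proof.
move=> c0; elim: s => [|i s [e e0 es]]; first by exists 1.
exists (Num.min e (c i)); first by rewrite lt_min e0 c0.
by move=> j [<-|/es]; rewrite ge_min ?lexx ?orbT// => ->.
Qed.

(** The directed set consists of the finite lists of constraints, ordered by
    inclusion. *)
Lemma net_of_finite_intersections (T I : Type) (B : set T) (E : I -> set T) :
  (forall s : seq I, exists2 x, B x & forall i, List.In i s -> E i x) ->
  exists x : net T, (forall a, B (x a)) /\
    forall i, \forall a \near @tails (net_dom x), E i (x a).
Proof.
move=> h; pose pt s := projT1 (cid2 (h s)).
pose D := @Directed (seq I) (fun s t => forall i, List.In i s -> List.In i t)
  (inhabits [::]) (fun s i h => h) (fun s t u st tu i h => tu i (st i h))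
  (fun s t => ex_intro _ (s ++ t) (conj (fun i h => List.in_or_app s t i (or_introl h))
     (fun i h => List.in_or_app s t i (or_intror h)))).
exists (@Net T D pt); split=> [s|i]; first by rewrite /= /pt; case: cid2.
exists [:: i] => s /(_ i (or_introl erefl)) si; rewrite /= /pt.
by case: cid2 => x _ /=; exact.
Qed.

End Nets.

Section Extensions.
Variables (R : realType) (X : normedModType R[i]).
Implicit Types (F : seq X -> Cplx R) (x y : X) (M : R) (z : dual (dual X)) (G : set_system X).

Lemma cvg_weak_star (T : Type) (G : set_system T) (w : T -> dual (dual X)) z :
  Filter G -> w @ G --> (z : weak_star (dual X)) <->
  forall phi : dual X, (fun t => w t phi) @ G --> z phi.
Proof.
move=> FG; have FwG : Filter (w @ G) by exact: fmap_filter.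
split=> [/cvg_initial /cvg_ptws|h].
  by move=> h phi; exact: (h phi).
by apply/cvg_initial; apply/cvg_ptws => phi; exact: (h phi).
Qed.

(** Goldstine's theorem is applied in a ball that contains z; the net ranges over the
    pairs of a functional and a precision. *)
Lemma weak_star_net z : exists N : net X,
  bidual_embed (X := X) @ net_lim N --> (z : weak_star (dual X)).
Proof.
pose r := rnorm z + 1.
have r0 : 0 < r by rewrite ltr_wpDl ?rnorm_ge0.
have zr : rnorm z <= r by rewrite lerDl.
have [|N [_ hN]] := @net_of_finite_intersections X (dual X * nat) setT
   (fun i => [set x | rnorm (z i.1 - i.1 x) < i.2.+1%:R^-1]).
  move=> s.
  have [|e e0 es] := @positive_lower_bound R _ (fun i => i.2.+1%:R^-1) s.
    by move=> i; rewrite invr_gt0 ltr0n.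
  have [x xr hx] := goldstine [seq i.1 | i <- s] r0 zr e0.
  exists x => // i si /=; apply: lt_le_trans (es _ si); apply: hx.
  elim: s si {es} => // j s ih [->|si]; first by rewrite mem_head.
  by rewrite inE ih ?orbT.
exists N; have FN := tails_proper (net_dom N).
apply/cvg_weak_star => phi; apply/cvg_rnormP => e e0.
have [n] := ltr_add_invr e0; rewrite add0r => ne.
by apply: filterS (hN (phi, n)) => a h; apply: lt_trans ne.
Qed.

Lemma iterated_lim_unique m (N : 'I_m -> net X) A (l l' : Cplx R) :
  iterated_lim N A l -> iterated_lim N A l' -> l = l'.
Proof.
elim: m N A l l' => [|m ih] N A l l' /=; first by move=> <- <-.
move=> [g [hg gl]] [g' [hg' gl']].
have gg' : g = g' by apply/funext => a; exact: ih (hg a) (hg' a).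
rewrite -gg' in gl'.
have FN := tails_proper (net_dom (N ord0)).
exact: cvg_rnorm_unique gl gl'.
Qed.

(** At each level, weak-star convergence is tested on the functional that sends x
    to F (x, z, ..., z). *)
Lemma iterated_lim_abval z m M F (N : 'I_m -> net X) :
  0 <= M -> symform m M F ->
  (forall i, bidual_embed (X := X) @ net_lim (N i) --> (z : weak_star (dual X))) ->
  iterated_lim N (@fun_form R X m F) (abval z m F).
Proof.
elim: m M F N => [|m ih] M F N M0 FF Nz.
  by rewrite /= /fun_form (size0nil (size_enum_ord 0)).
exists (fun a => abval z m (fun s => F (N ord0 a :: s))); split=> [a|].
  have -> : (fun v => fun_form F (args_cons (N ord0 a) v)) =
      @fun_form R X m (fun s => F (N ord0 a :: s)).
    apply/funext => v; rewrite /fun_form enum_ordSl /= -map_comp.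
    congr (F (_ :: _)); first by rewrite /args_cons unlift_none.
    by apply: eq_map => j; rewrite /= /args_cons liftK.
  apply: (ih (M * rnorm (N ord0 a))) => [||i].
  - by rewrite mulr_ge0 ?rnorm_ge0.
  - exact: symform_cons.
  - exact: Nz.
have FN := tails_proper (net_dom (N ord0)).
have /(cvg_weak_star (bidual_embed (X := X) \o N ord0)) h := Nz ord0.
have := h (dualize (fun x => abval z m (fun s => F (x :: s)))).
rewrite /= (dualizeE (abval_cons_dual z M0 FF)); exact.
Qed.

(** The iterated limits all equal [abval]; a net converging weak-star to z exists,
    so that no other value satisfies the defining condition. *)
Lemma ext_form_abval z m M F : 0 <= M -> symform m M F ->
  ext_form (@fun_form R X m F) (fun=> z) = abval z m F.
Proof.
move=> M0 FF; apply: xget_unique => [N Nz|l hl].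
  exact: iterated_lim_abval FF Nz.
have [N Nz] := weak_star_net z.
exact: (iterated_lim_unique (hl (fun=> N) (fun=> Nz)) (iterated_lim_abval M0 FF (fun=> Nz))).
Qed.

Lemma ext_homogP m (P : X -> Cplx R) : homog_poly m P ->
  exists M F, [/\ 0 <= M, symform m M F, forall x, P x = F (nseq m x) &
    forall z, ext_homog m P z = abval z m F].
Proof.
move=> hP; have /assoc_form_symform[M [M0 FA PA]] :=
  @xgetPex _ (fun=> 0) [set A : ('I_m -> X) -> Cplx R | assoc_form P A] hP.
exists M, (seq_form (xget (fun=> 0) [set A : ('I_m -> X) -> Cplx R | assoc_form P A])).
by split=> // z; rewrite -(ext_form_abval z M0 FA) fun_formE.
Qed.

Lemma ext_homog_embed m (P : X -> Cplx R) x : homog_poly m P ->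
  ext_homog m P (bidual_embed x) = P x.
Proof.
by move=> /ext_homogP[M [F [M0 FF PF ->]]]; rewrite (abval_embed x M0 FF) PF.
Qed.

Lemma ext_polyP (P : X -> Cplx R) z : cont_poly P ->
  exists n Q, poly_sum n Q P /\ ext_poly P z = \sum_(m < n) ext_homog m (Q m) z.
Proof.
move=> [n [Q PQ]]; pose S := [set l : Cplx R | exists n Q,
    poly_sum n Q P /\ l = \sum_(m < n) ext_homog m (Q m) z].
have /(xgetPex 0) : exists l, S l by exists (\sum_(m < n) ext_homog m (Q m) z), n, Q.
by [].
Qed.

Lemma ext_poly_embed (P : X -> Cplx R) x : cont_poly P ->
  ext_poly P (bidual_embed x) = P x.
Proof.
move=> /(ext_polyP (bidual_embed x))[n [Q [[hQ PQ] ->]]].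
by rewrite PQ; apply: eq_bigr => m _; exact: ext_homog_embed.
Qed.

(** Convergence tested on homogeneous polynomials only; it is equivalent to
    polynomial-star convergence by [converges_toP]. *)
Definition converges_to z G :=
  forall m P, homog_poly m P -> P @ G --> ext_homog m P z.

Lemma cvg_sum_homog z G n (Q : nat -> X -> Cplx R) : Filter G -> converges_to z G ->
  (forall m, homog_poly m (Q m)) ->
  (fun x => \sum_(m < n) Q m x) @ G --> \sum_(m < n) ext_homog m (Q m) z.
Proof.
move=> FG Gz hQ; elim: n => [|n ih].
  under eq_fun do rewrite big_ord0.
  by rewrite big_ord0; exact: cvg_cst.
under eq_fun do rewrite big_ord_recr.
by rewrite big_ord_recr /=; apply: cvgD ih _; exact: Gz.
Qed.

(** By [davie_gamelin] every finite set of conditions |A(z^m) - A(x^m)| < 1/(n+1) is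
    met in the open ball, also when the norm of z is r. *)
Lemma homog_net z (r : R) : 0 < r -> rnorm z <= r ->
  exists N : net X, (forall a, rball r (N a)) /\ converges_to z (net_lim N).
Proof.
move=> r0 zr.
pose I := {i : nat * R * (seq X -> Cplx R) | 0 <= i.1.2 /\ symform i.1.1 i.1.2 i.2}.
pose mI (i : I * nat) := (proj1_sig i.1).1.1.
pose MI (i : I * nat) := (proj1_sig i.1).1.2.
pose FI (i : I * nat) := (proj1_sig i.1).2.
have MI0 i : 0 <= MI i by case: (proj2_sig i.1).
have FFI i : symform (mI i) (MI i) (FI i) by case: (proj2_sig i.1).
have [|N [Nr hN]] := @net_of_finite_intersections X (I * nat) (rball r)
  (fun i => [set x | rnorm (abval z (mI i) (FI i) - FI i (nseq (mI i) x)) < i.2.+1%:R^-1]).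
  move=> s.
  have [|e e0 es] := @positive_lower_bound R _ (fun i => i.2.+1%:R^-1) s.
    by move=> i; rewrite invr_gt0 ltr0n.
  have [x xr hx] := davie_gamelin r0 zr s MI0 FFI e0.
  by exists x => // i si /=; apply: lt_le_trans (es _ si); exact: hx.
exists N; split=> // m P /ext_homogP[M [F [M0 FF PF ->]]].
have FN := tails_proper (net_dom N).
apply/cvg_rnormP => e e0.
have [n] := ltr_add_invr e0; rewrite add0r => ne.
pose i : I := exist _ (m, M, F) (conj M0 FF).
have hi := hN (i, n); rewrite /net_lim; apply: filterS hi => a h.
by rewrite /= PF; apply: lt_trans ne.
Qed.

(** Both sides are the limit of P along the net of [homog_net]. *)
Lemma ext_poly_homog m (P : X -> Cplx R) z : homog_poly m P -> cont_poly P ->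
  ext_poly P z = ext_homog m P z.
Proof.
move=> hP cP; pose r := rnorm z + 1.
have r0 : 0 < r by rewrite ltr_wpDl ?rnorm_ge0.
have zr : rnorm z <= r by rewrite lerDl.
have [N [_ hN]] := homog_net r0 zr.
have FN := net_lim_proper N.
have [n [Q [[hQ PQ] ->]]] := ext_polyP z cP.
apply: (@cvg_rnorm_unique R (Cplx R) X (net_lim N) _ P); last exact: hN.
have -> : P = fun x => \sum_(i < n) Q i x by apply/funext.
exact: cvg_sum_homog.
Qed.

Lemma cvg_polystar (T : Type) (G : set_system T) (w : T -> dual (dual X)) z :
  Filter G -> w @ G --> (z : polystar X) <->
  forall P : X -> Cplx R, cont_poly P -> (fun t => ext_poly P (w t)) @ G --> ext_poly P z.
Proof.
move=> FG; have FwG : Filter (w @ G) by exact: fmap_filter.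
split=> [/cvg_sup h P cP|h].
  by have /cvg_initial := h (exist _ P cP).
by apply/cvg_sup => -[P cP]; apply/cvg_initial; exact: h.
Qed.

End Extensions.

(** * Polynomials are entire of bounded type *)

Section Filters.
Variable R : realType.

Lemma cvg_uniform_rnormP (X : choiceType) (A : set X) (T : Type) (G : set_system T)
    (w : T -> X -> Cplx R) (f : X -> Cplx R) : Filter G ->
  {uniform A, w @ G --> f} <->
  forall e : R, 0 < e -> \forall t \near G, forall x, A x -> rnorm (f x - w t x) < e.
Proof.
move=> FG; split=> [h e e0|h U /uniform_nbhs[E [entE EU]]].
  have /h : nbhs (f : {uniform` A -> Cplx R})
      [set g | forall x, A x -> rnorm (f x - g x) < e].
    apply/uniform_nbhs; exists [set xy | ball xy.1 e%:C xy.2]; split.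
      by rewrite -entourage_ballE; exists e%:C => //=; rewrite ltcR.
    move=> g /= gE x Ax; have := gE x Ax.
    by rewrite -[ball _ _ _]/(is_true (`|f x - g x| < e%:C)) rnormE ltcR.
  by [].
have : entourage_ (@ball _ (Cplx R)) E by rewrite entourage_ballE.
move=> [e /= e0 eE].
have er : e = (complex.Re e)%:C by rewrite RRe_real// gtr0_real.
move: e0; rewrite er ltcR => /h; apply: filterS => t ht; apply: EU => x Ax.
apply: eE; rewrite /= -[ball _ _ _]/(is_true (`|f x - w t x| < e)) er rnormE ltcR.
exact: ht.
Qed.

Lemma bounded_setP (V : normedModType R[i]) (A : set V) : bounded_set A <->
  exists M : R, forall x, A x -> rnorm x <= M.
Proof.
split=> [/pinfty_ex_gt0[M M0 AM]|[M AM]].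
  exists (complex.Re M) => x Ax; rewrite -lecR -rnormE RRe_real ?gtr0_real//.
  exact: AM.
exists M%:C; split; first by apply/complex_realP; exists M.
move=> B MB x Ax /=; apply: le_trans (ltW MB); rewrite rnormE lecR; exact: AM.
Qed.

Lemma cvg_rnorm_le (V : normedModType R[i]) (T : Type) (G : set_system T)
    (w : T -> V) (l : V) (c : R) : ProperFilter G ->
  w @ G --> l -> (\forall t \near G, rnorm (w t) <= c) -> rnorm l <= c.
Proof.
move=> FG /cvg_rnormP wl wc; apply/ler_addgt0Pr => e e0.
have [t [h1 h2]] := filter_ex (filterI (wl e e0) wc).
by have := rnormD (l - w t) (w t); rewrite subrK; lra.
Qed.

(** The limit is the supremum of the lower estimates a n - c n. *)
Lemma cvg_of_summable_gap (a c : nat -> R) :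
  (forall n k, `|a n - a k| <= c n + c k) -> exists l, forall n, `|a n - l| <= c n.
Proof.
move=> h; pose S := [set a n - c n | n in setT].
have Sub k : ubound S (a k + c k).
  by move=> _ [n _ <-]; have := h n k; rewrite ler_norml; lra.
have S0 : S !=set0 by exists (a 0%N - c 0%N), 0%N.
exists (sup S) => n; rewrite ler_norml.
have h1 : a n - c n <= sup S.
  by apply: ub_le_sup; [exists (a 0%N + c 0%N); exact: Sub|exists n].
have h2 : sup S <= a n + c n by apply: ge_sup => //; exact: Sub.
lra.
Qed.

(** Completeness of the complex numbers in the form needed here, with a rate. *)
Lemma rcvg_of_summable_gap (a : nat -> R[i]) (c : nat -> R) :
  (forall n k, rnorm (a n - a k) <= c n + c k) ->
  exists l, forall n, rnorm (a n - l) <= 2 * c n.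
Proof.
move=> h.
have [x hx] : exists l, forall n, `|complex.Re (a n) - l| <= c n.
  apply: cvg_of_summable_gap => n k; rewrite -ReN -ReD.
  exact: le_trans (normRe_le _) (h n k).
have [y hy] : exists l, forall n, `|complex.Im (a n) - l| <= c n.
  apply: cvg_of_summable_gap => n k; rewrite -ImN -ImD.
  exact: le_trans (normIm_le _) (h n k).
exists (Complex x y) => n; apply: le_trans (rnorm_le_ReIm _) _.
by rewrite ReD ReN ImD ImN /=; have := hx n; have := hy n; lra.
Qed.

Lemma geometric_lt (M e : R) : 0 < e -> \forall n \near \oo, M / 2 ^+ n < e.
Proof.
move=> e0; exists (Num.bound (`|M| / e)) => // n /= hn.
rewrite ltr_pdivrMr ?exprn_gt0// mulrC -ltr_pdivrMr//.
apply: (@le_lt_trans _ _ (`|M| / e)); first by rewrite ler_pM2r ?invr_gt0// ler_norm.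
apply: lt_le_trans (archi_boundP _) _; first by rewrite divr_ge0// ltW.
by rewrite -natrX ler_nat (leq_trans hn)// ltnW// ltn_expl.
Qed.

Lemma cvg_geometric_bound (V : normedModType R[i]) (a : nat -> V) (l : V) (M : R) :
  (forall n, rnorm (l - a n) <= M / 2 ^+ n) -> a @ \oo --> l.
Proof.
move=> h; apply/cvg_rnormP => e /(geometric_lt M).
by apply: filterS => n; exact: le_lt_trans.
Qed.

End Filters.

Section PolynomialsAreEntire.
Variables (R : realType) (X : normedModType R[i]).
Implicit Types (F : seq X -> Cplx R) (P Q : X -> Cplx R) (f g : X -> Cplx R).

Lemma homog_poly_comb m P Q (a : R[i]) : homog_poly m P -> homog_poly m Q ->
  homog_poly m (fun x => a * P x + Q x).
Proof.
move=> /homog_polyP[M [F [M0 FF PF]]] /homog_polyP[N [G [N0 GG QG]]].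
apply/homog_polyP; exists (rnorm a * M + N), (fun s => a * F s + G s).
split; [by rewrite addr_ge0 ?mulr_ge0 ?rnorm_ge0|exact: symform_comb|].
by move=> x; rewrite PF QG.
Qed.

Lemma homog_poly0 m : homog_poly m (fun _ : X => 0 : Cplx R).
Proof.
apply/homog_polyP; exists 0, (fun=> 0); split=> //.
by split=> [s sm a x y|s _|//]; rewrite ?scaler0 ?addr0// rnorm0 mul0r.
Qed.

Lemma homog_poly_cst (c : R[i]) : homog_poly 0 (fun _ : X => c : Cplx R).
Proof.
apply/homog_polyP; exists (rnorm c), (fun=> c); split=> //; first exact: rnorm_ge0.
by split=> // s /size0nil->; rewrite big_nil mulr1.
Qed.

(** Padding the components with zeros makes sums of polynomials of different
    degrees easy, and shows that the Taylor series of a polynomial is finite. *)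
Lemma cont_poly_truncated P : cont_poly P <-> exists n (Q : nat -> X -> Cplx R),
  (forall m, homog_poly m (Q m)) /\
  forall N x, (n <= N)%N -> P x = \sum_(m < N) Q m x.
Proof.
split=> [[n [Q [hQ PQ]]]|[n [Q [hQ PQ]]]]; last first.
  by exists n, Q; split=> // x; exact: PQ.
exists n, (fun m => if (m < n)%N then Q m else fun=> 0); split=> [m|N x nN].
  by case: ifP => // _; exact: homog_poly0.
rewrite PQ (big_ord_widen _ (Q^~ x) nN) big_mkcond /=.
by apply: eq_bigr => m _; case: ifP.
Qed.

Lemma cont_polyD P Q : cont_poly P -> cont_poly Q -> cont_poly (fun x => P x + Q x).
Proof.
move=> /cont_poly_truncated[n [P' [hP PP]]] /cont_poly_truncated[k [Q' [hQ QQ]]].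
apply/cont_poly_truncated; exists (maxn n k), (fun m x => 1 * P' m x + Q' m x).
split=> [m|N x]; first exact: homog_poly_comb.
rewrite geq_max => /andP[nN kN]; rewrite (PP N)// (QQ N)// -big_split.
by apply: eq_bigr => m _; rewrite /= mul1r.
Qed.

Lemma homog_cont_poly m P : homog_poly m P -> cont_poly P.
Proof.
move=> hP; exists m.+1, (fun k => if k == m then P else fun=> 0); split=> [k|x].
  by case: eqP => [->//|_]; exact: homog_poly0.
rewrite (bigD1 ord_max)//= eqxx big1 ?addr0// => k; rewrite -val_eqE /=.
by case: eqP.
Qed.

(** Expanding one of the variables equal to a + h by linearity either fixes it to a
    or makes it equal to h; the induction is on the number of variables equal to
    a + h. *)
Lemma cont_poly_translate m P a : homog_poly m P -> cont_poly (fun h => P (a + h)).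
Proof.
move=> /homog_polyP[M [F [M0 FF PF]]].
suff gen k j M' F' : 0 <= M' -> symform (k + j) M' F' ->
    cont_poly (fun h => F' (nseq j h ++ nseq k (a + h))).
  have := gen m 0%N M F M0; rewrite addn0 => /(_ FF).
  by congr cont_poly; apply/funext => h; rewrite PF.
elim: k j M' F' {M F M0 FF PF} => [|k ih] j M F M0 FF.
  apply: (@homog_cont_poly j); apply/homog_polyP; exists M, F.
  by split=> // h; rewrite cats0.
have -> : (fun h => F (nseq j h ++ nseq k.+1 (a + h))) =
    (fun h => F (a :: (nseq j h ++ nseq k (a + h))) + F (nseq j.+1 h ++ nseq k (a + h))).
  apply/funext => h.
  have mv : F (nseq j h ++ nseq k.+1 (a + h)) = F ((a + h) :: (nseq j h ++ nseq k (a + h))).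
    apply: (symform_perm FF); first by rewrite size_cat !size_nseq addnC.
    by rewrite /= perm_catC /= perm_cons perm_catC.
  have := symform_linear FF (s := nseq j h ++ nseq k (a + h)).
  rewrite size_cat !size_nseq addnC addSn => /(_ erefl 1 a h).
  by rewrite mv !scale1r.
apply: cont_polyD.
  by apply: (ih j (M * rnorm a) (fun s => F (a :: s)));
    [rewrite mulr_ge0 ?rnorm_ge0|exact: symform_cons].
by apply: (ih j.+1 M F) => //; rewrite addnS -addSn.
Qed.

Lemma taylor_seriesP f a (Q : nat -> X -> Cplx R) : taylor_series f a Q <->
  (forall m, homog_poly m (Q m)) /\ exists2 e : R, 0 < e &
    forall d : R, 0 < d -> \forall n \near \oo, forall x, rnorm (x - a) < e ->
      rnorm (f x - \sum_(m < n) Q m (x - a)) < d.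
Proof.
have oballE (e : R) x : (`|x - a| < e%:C) = (rnorm (x - a) < e) by rewrite rnormE ltcR.
split=> -[hQ [e e0 he]]; split=> //; exists e => //.
  move=> d d0; have /cvg_uniform_rnormP/(_ d d0) := he.
  by apply: filterS => n h x xe; apply: h; rewrite /= oballE.
apply/cvg_uniform_rnormP => d /he; apply: filterS => n h x.
by rewrite /= oballE; exact: h.
Qed.

Lemma entire_comb f g (c : R[i]) : entire f -> entire g ->
  entire (fun x => c * f x + g x).
Proof.
move=> ef eg a.
have [Q /taylor_seriesP[hQ [e e0 he]]] := ef a.
have [P /taylor_seriesP[hP [d d0 hd]]] := eg a.
exists (fun m x => c * Q m x + P m x); apply/taylor_seriesP; split.
  by move=> m; exact: homog_poly_comb.
exists (Num.min e d); first by rewrite lt_min e0.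
move=> t t0; pose C := rnorm c + 1.
have C0 : 0 < C by rewrite ltr_wpDl ?rnorm_ge0.
have t2 : 0 < t / 2 by rewrite divr_gt0.
have tC : 0 < t / 2 / C by rewrite divr_gt0.
have := he _ tC; have := hd _ t2; apply: filterS2 => n h1 h2 x.
rewrite lt_min => /andP[/h2 {}h2 /h1 {}h1].
rewrite big_split /= -mulr_sumr.
have -> : c * f x + g x - (c * \sum_(m < n) Q m (x - a) + \sum_(m < n) P m (x - a)) =
  c * (f x - \sum_(m < n) Q m (x - a)) + (g x - \sum_(m < n) P m (x - a)).
  by rewrite mulrBr opprD addrACA.
apply: le_lt_trans (rnormD _ _) _; rewrite rnormM (splitr t); apply: ler_ltD h1.
rewrite ltr_pdivlMr// mulrC in h2; apply: le_trans (ltW h2).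
by rewrite ler_wpM2r ?rnorm_ge0// lerDl.
Qed.

Lemma homog_poly_bound m P : homog_poly m P ->
  exists2 M : R, 0 <= M & forall r x, 0 <= r -> rnorm x <= r -> rnorm (P x) <= M * r ^+ m.
Proof.
move=> /homog_polyP[M [F [M0 FF PF]]]; exists M => // r x r0 xr.
rewrite PF; apply: le_trans (symform_bound FF _) _; first by rewrite size_nseq.
by rewrite ler_wpM2l// big_nseq -Monoid.iteropE lerXn2r// nnegrE rnorm_ge0.
Qed.

Lemma Hb_set_homog m P : homog_poly m P -> Hb_set P.
Proof.
move=> hP; split=> [a|A /bounded_setP[r rA]]; last first.
  have [M M0 hM] := homog_poly_bound hP.
  apply/bounded_setP; exists (M * `|r| ^+ m) => _ [x Ax <-].
  by apply: hM => //; apply: le_trans (rA _ Ax) (ler_norm _).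
have /cont_poly_truncated[n [Q [hQ PQ]]] := cont_poly_translate a hP.
exists Q; apply/taylor_seriesP; split=> //; exists 1 => // d d0.
by exists n => // N /= nN x _; rewrite -(PQ N)// subrKC subrr rnorm0.
Qed.

Lemma Hb_set_comb f g (c : R[i]) : Hb_set f -> Hb_set g ->
  Hb_set (fun x => c * f x + g x).
Proof.
move=> [ef bf] [eg bg]; split; first exact: entire_comb.
move=> A bA; have /bounded_setP[M hM] := bf A bA; have /bounded_setP[N hN] := bg A bA.
apply/bounded_setP; exists (rnorm c * M + N) => _ [x Ax <-].
apply: le_trans (rnormD _ _) _; rewrite rnormM; apply: lerD; last by apply: hN; exists x.
by apply: ler_wpM2l; [exact: rnorm_ge0|apply: hM; exists x].
Qed.

Definition to_Hb f (hf : Hb_set f) : Hb X := exist _ f (mem_set hf).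

Lemma to_HbE f (hf : Hb_set f) : Hb_fun (to_Hb hf) = f.
Proof. by rewrite /Hb_fun set_valE. Qed.

Lemma Hb_setP (f : Hb X) : Hb_set (Hb_fun f).
Proof. by rewrite /Hb_fun set_valE; case: f => f /= /set_mem. Qed.

End PolynomialsAreEntire.

(** * Taylor series and the cluster value theorem *)

Section TaylorBound.
Variables (R : realType) (X : normedModType R[i]).
Implicit Types (f : X -> Cplx R) (Q : nat -> X -> Cplx R).

(** Convergence at the point d/2 bounds b j (d/2)^j; for |w| < d/4 the tails are then
    dominated by a geometric series of ratio at most 1/2. *)
Lemma expands_of_cvg (h : R[i] -> R[i]) (b : nat -> R[i]) (d : R) : 0 < d ->
  (forall w, rnorm w < d -> forall e : R, 0 < e ->
    \forall n \near \oo, rnorm (h w - \sum_(j < n) b j * w ^+ j) < e) ->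
  expands h b.
Proof.
move=> d0 hb k; pose S w n := \sum_(j < n) b j * w ^+ j.
have bnd : exists2 K : R, 0 <= K & forall j, rnorm (b j) * (d / 2) ^+ j <= K.
  have d2 : rnorm ((d / 2)%:C : R[i]) = d / 2 by rewrite rnormR gtr0_norm// divr_gt0.
  have [|N _ hN] := hb (d / 2)%:C _ 1 ltr01; first by rewrite d2; lra.
  have tl j : (N <= j)%N -> rnorm (b j) * (d / 2) ^+ j <= 2.
    move=> Nj; rewrite -{1}d2 -rnormX -rnormM.
    have -> : b j * (d / 2)%:C ^+ j = S (d / 2)%:C j.+1 - S (d / 2)%:C j.
      by rewrite /S big_ord_recr /= addrAC subrr add0r.
    apply: le_trans (rnorm_distD (h (d / 2)%:C) _ _) _.
    have := hN j.+1 (leqW Nj); have := hN j Nj; rewrite /= -/(S _ _) -/(S _ _).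
    by rewrite (rnorm_distC (S _ j.+1)); lra.
  exists (\sum_(j < N) rnorm (b j) * (d / 2) ^+ j + 2).
    by rewrite addr_ge0// sumr_ge0// => j _;
      rewrite mulr_ge0 ?rnorm_ge0// exprn_ge0// divr_ge0// ltW.
  have t0 j : 0 <= rnorm (b j) * (d / 2) ^+ j.
    by rewrite mulr_ge0 ?rnorm_ge0// exprn_ge0// divr_ge0// ltW.
  move=> j; case: (leqP N j) => [/tl h1|jN].
    by apply: le_trans h1 _; rewrite lerDr sumr_ge0.
  rewrite (bigD1 (Ordinal jN))//= -addrA lerDl addr_ge0// sumr_ge0//.
have [K K0 hK] := bnd.
exists (2 * K * (2 / d) ^+ k), (d / 4); split; first by rewrite divr_gt0.
  by rewrite !mulr_ge0// exprn_ge0// divr_ge0// ltW.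
move=> w wd; pose q := rnorm w * (2 / d).
have q0 : 0 <= q by rewrite mulr_ge0 ?rnorm_ge0// divr_ge0// ltW.
have q2 : q <= 2^-1 by rewrite /q mulrA ler_pdivrMr//; lra.
have term j : rnorm (b j * w ^+ j) <= K * q ^+ j.
  rewrite rnormM rnormX; apply: le_trans (ler_wpM2r _ (hK j)); last by rewrite exprn_ge0.
  rewrite -mulrA -exprMn /q mulrCA.
  have -> : d / 2 * (2 / d) = 1 by rewrite -[2 / d]invf_div mulfV// gt_eqF// divr_gt0.
  by rewrite mulr1.
have tail n : rnorm (S w (k + n)%N - S w k) <= K * q ^+ k * (2 - 2 / 2 ^+ n).
  elim: n => [|n ih]; first by rewrite addn0 subrr rnorm0 expr0 divr1 subrr mulr0.
  have -> : S w (k + n.+1)%N - S w k = S w (k + n)%N - S w k + b (k + n)%N * w ^+ (k + n).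
    by rewrite /S addnS big_ord_recr /= addrAC.
  apply: le_trans (rnormD _ _) _; apply: le_trans (lerD ih (term _)) _.
  rewrite exprD mulrA -mulrDr ler_wpM2l ?mulr_ge0 ?exprn_ge0//.
  have : q ^+ n <= 2^-1 ^+ n by rewrite lerXn2r// nnegrE.
  rewrite exprVn exprS invfM; set p := (2 ^+ n)^-1; lra.
have Kq : 0 <= K * q ^+ k by rewrite mulr_ge0 ?exprn_ge0.
have -> : 2 * K * (2 / d) ^+ k * rnorm w ^+ k = 2 * (K * q ^+ k).
  have -> : q ^+ k = rnorm w ^+ k * (2 / d) ^+ k by exact: exprMn.
  by ring.
apply/ler_addgt0Pr => e e0.
have [|N _ hN] := hb w _ e e0; first by lra.
have := hN (k + N)%N (leq_addl _ _); rewrite /= -/(S _ _) => h1.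
have h2 := tail N.
apply: le_trans (rnorm_distD (S w (k + N)%N) _ _) _; rewrite -/(S _ _).
have : 0 <= K * q ^+ k * (2 / 2 ^+ N) by rewrite mulr_ge0// divr_ge0// exprn_ge0.
rewrite mulrBr in h2; lra.
Qed.

Lemma homog_polyZ m (P : X -> Cplx R) (w : R[i]) x : homog_poly m P ->
  P (w *: x) = w ^+ m * P x.
Proof.
move=> /homog_polyP[M [F [M0 FF PF]]]; rewrite !PF {P PF}.
elim: m M F M0 FF => [|m ih] M F M0 FF; first by rewrite expr0 mul1r.
have FZ s : size s = m -> F (w *: x :: s) = w * F (x :: s).
  move=> sm; have lF := symform_linear FF (congr1 S sm).
  have F0 : F (0 :: s) = 0 by have := lF (-1) 0 0; rewrite !scaleN1r !addNr.
  by have := lF w x 0; rewrite !addr0 F0 addr0.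
rewrite /= FZ ?size_nseq// (ih (M * rnorm x) (fun s => F (x :: s))).
- by rewrite exprS mulrA.
- by rewrite mulr_ge0 ?rnorm_ge0.
- exact: symform_cons.
Qed.

Lemma taylor_expands f a Q x : taylor_series f a Q ->
  expands (fun w => f (a + w *: x)) (fun j => Q j x).
Proof.
move=> /taylor_seriesP[hQ [e e0 he]].
have x1 : 0 < rnorm x + 1 by rewrite ltr_wpDl ?rnorm_ge0.
apply: (@expands_of_cvg _ _ (e / (rnorm x + 1))); first by rewrite divr_gt0.
move=> w wd d d0; apply: filterS (he d d0) => n /(_ (a + w *: x)).
rewrite addrAC subrr add0r rnormZ => h.
have -> : \sum_(j < n) Q j x * w ^+ j = \sum_(j < n) Q j (w *: x).
  by apply: eq_bigr => j _; rewrite (homog_polyZ w x (hQ j)) mulrC.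
apply: h; rewrite ltr_pdivlMr// in wd; apply: le_lt_trans wd.
by rewrite ler_wpM2l ?rnorm_ge0// lerDl.
Qed.

(** [schwarz_iteration] for the restrictions w |-> f (w x) to complex lines; the
    square of half-side 4 is mapped into the ball of radius 8r, where f is
    bounded. *)
Lemma Hb_taylor_bound f Q (r : R) : 0 < r -> Hb_set f -> taylor_series f 0 Q ->
  exists M : R, forall x, rball r x -> forall k,
    rnorm (f x - \sum_(j < k) Q j x) <= M / 2 ^+ k.
Proof.
move=> r0 [ef bf] fQ.
have /bf/bounded_setP[M hM] : bounded_set [set x : X | rnorm x <= 8 * r].
  by apply/bounded_setP; exists (8 * r).
exists M => x xr k.
have := @schwarz_iteration R k (fun w => f (w *: x)) (fun j => Q j x) M.
rewrite scale1r; apply.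
- move=> a _; have [Q' fQ'] := ef (a *: x).
  have [c1 [c2 [K [d [d0 K0 hd]]]]] := expands_jet2 (taylor_expands x fQ').
  exists c1, c2, K, d; split=> // w wd; have := hd w wd.
  by rewrite add0r scale0r addr0 scalerDl.
- have := taylor_expands x fQ; congr expands.
  by apply/funext => w; rewrite add0r.
- move=> l [l1 l2]; apply: hM; exists (l *: x) => //=.
  rewrite rnormZ; apply: ler_pM; rewrite ?rnorm_ge0 ?(ltW xr)//.
  by apply: le_trans (rnorm_le_ReIm _) _; lra.
Qed.

End TaylorBound.

Section ClusterValue.
Variables (R : realType) (X : normedModType R[i]).
Implicit Types (f g h : Hb X) (P : X -> Cplx R) (z : dual (dual X)) (G : set_system X).

Lemma cvg_cont_poly z G P : Filter G -> converges_to z G -> cont_poly P ->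
  P @ G --> ext_poly P z.
Proof.
move=> FG Gz cP; have [n [Q [[hQ PQ] ->]]] := ext_polyP z cP.
by rewrite (_ : P = fun x => \sum_(m < n) Q m x); [exact: cvg_sum_homog|exact/funext].
Qed.

Lemma converges_toP z G : Filter G -> converges_to z G <->
  bidual_embed (X := X) @ G --> (z : polystar X).
Proof.
move=> FG; split=> [Gz|/cvg_polystar Gz m P hP].
  apply/cvg_polystar => P cP; under eq_fun do rewrite ext_poly_embed//.
  exact: cvg_cont_poly.
have cP := homog_cont_poly hP; rewrite -(ext_poly_homog z hP cP).
by have := Gz P cP; under eq_fun do rewrite ext_poly_embed//.
Qed.

(** An exchange of limits: the partial sums converge along G, and they approximate g
    uniformly on a set of G. *)
Lemma cvg_ext_entire z G (r : R) g : ProperFilter G -> 0 < r ->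
  converges_to z G -> (\forall x \near G, rball r x) ->
  g @ G --> ext_entire g z.
Proof.
move=> FG r0 Gz Gr.
pose Q := xget (fun _ _ => 0) [set Q | taylor_series g 0 Q].
have gQ : taylor_series g 0 Q by exact: (xgetPex _ ((Hb_setP g).1 0)).
have [M hM] := Hb_taylor_bound r0 (Hb_setP g) gQ.
pose L n : Cplx R := \sum_(m < n) ext_homog m (Q m) z.
have SL n : (fun x => \sum_(m < n) Q m x) @ G --> L n.
  by apply: cvg_sum_homog => //; case: gQ.
have near_bound n : \forall x \near G, rnorm (g x - \sum_(m < n) Q m x) <= M / 2 ^+ n.
  by apply: filterS Gr => x /hM; exact.
have gap n k : rnorm (L n - L k) <= M / 2 ^+ n + M / 2 ^+ k.
  have LB : (fun x => \sum_(m < n) Q m x - \sum_(m < k) Q m x) @ G --> L n - L k.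
    exact: cvgB (SL n) (SL k).
  apply: (@cvg_rnorm_le R (Cplx R) _ _ _ _ _ FG LB).
  apply: filterS2 (near_bound n) (near_bound k) => x h1 h2.
  apply: le_trans (rnorm_distD (g x) _ _) _.
  by rewrite (rnorm_distC _ (g x)) lerD.
have [l hl] := rcvg_of_summable_gap gap.
have Ll : L @ \oo --> (l : Cplx R).
  apply: (@cvg_geometric_bound _ _ _ _ (2 * M)) => n.
  by rewrite rnorm_distC -mulrA; exact: hl.
have -> : ext_entire g z = l.
  by rewrite /ext_entire -/Q; apply: cvg_lim Ll; exact: norm_hausdorff.
apply/cvg_rnormP => e e0.
have e3 : 0 < e / 3 by rewrite divr_gt0.
have [n [h1 h2]] := filter_ex (filterI (geometric_lt M e3) ((cvg_rnormP _ _).1 Ll _ e3)).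
have /cvg_rnormP/(_ _ e3) := SL n.
have := near_bound n; apply: filterS2 => x h3 h4.
apply: le_lt_trans (rnorm_distD (L n) _ _) _.
have := rnorm_distD (\sum_(m < n) Q m x) (L n) (g x).
rewrite (rnorm_distC (\sum_(m < n) Q m x) (g x)); lra.
Qed.

Lemma oballE (r : R) : oball r = rball r :> set X.
Proof. by apply/funext => x; rewrite /oball /rball /= rnormE ltcR. Qed.

Lemma supnorm_le (r c : R) (g : X -> Cplx R) : 0 < r ->
  (forall x, rball r x -> rnorm (g x) <= c) -> supnorm (oball r) g <= c.
Proof.
move=> r0 gc; apply: ge_sup.
  by exists (Normc.normc (g 0)), 0 => //; rewrite oballE /rball/= rnorm0.
by move=> _ [x xr <-]; apply: gc; rewrite -oballE.
Qed.

Lemma le_supnorm (r : R) g x : rball r x -> rnorm (g x) <= supnorm (oball r) g.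
Proof.
move=> xr; apply: ub_le_sup; last by exists x; rewrite ?oballE.
have [_ bg] := Hb_setP g.
have /bg/bounded_setP[M hM] : bounded_set (rball r : set X).
  by apply/bounded_setP; exists r => y /ltW.
by exists M => _ [y yr <-]; apply: hM; exists y => //; rewrite -oballE.
Qed.

(** The ball is one of the bounded sets defining the topology of H_b(X). *)
Lemma nbhs_Hb_ball (r e : R) g : 0 < e ->
  nbhs g [set h : Hb X | forall x, rball r x -> rnorm (g x - h x) < e].
Proof.
move=> e0.
have FG : Filter (nbhs g) by exact: nbhs_filter.
have br : bounded_set (rball r : set X) by apply/bounded_setP; exists r => y /ltW.
have h1 : (fun h : Hb X => set_val h) @ nbhs g -->
    (set_val g : {family (bounded_set : set (set X)), X -> Cplx R}).
  exact: (@initial_continuous _ _ set_val g).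
have FG' : Filter ((fun h : Hb X => set_val h) @ nbhs g) by exact: fmap_filter.
have h2 := (@fam_cvgP X (Cplx R) (bounded_set : set (set X)) _ (set_val g) FG').1 h1 _ br.
exact: (@cvg_uniform_rnormP R X (rball r) (Hb X) (nbhs g)
  (fun h => set_val h) (set_val g) FG).1 h2 e e0.
Qed.

Lemma spectrum_additive (phi : Hb X -> Cplx R) : spectrum phi ->
  forall n (Q : nat -> Hb X) (S : Hb X), (forall x, S x = \sum_(m < n) Q m x) ->
    phi S = \sum_(m < n) phi (Q m).
Proof.
move=> [_ _ lphi _]; elim=> [|n ih] Q S hS.
  have S0 x : S x = 0 by rewrite hS big_ord0.
  have := lphi 1 S S S; rewrite mul1r => h.
  have {}h : phi S = phi S + phi S by apply: h => x; rewrite S0 mulr0 addr0.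
  rewrite big_ord0; apply: (addrI (phi S)); by rewrite -h addr0.
have hT : Hb_set (fun x => \sum_(m < n) Q m x).
  elim: n {ih S hS} => [|n ih].
    under eq_fun do rewrite big_ord0; exact: Hb_set_homog (homog_poly0 X 0).
  under eq_fun do rewrite big_ord_recr /= addrC -[Q n _]mul1r.
  apply: Hb_set_comb ih; exact: Hb_setP.
rewrite big_ord_recr /= -(ih Q (to_Hb hT)); last by move=> x; rewrite to_HbE.
rewrite (lphi 1 (Q n) (to_Hb hT)) ?mul1r 1?addrC// => x.
by rewrite hS big_ord_recr /= to_HbE mul1r addrC.
Qed.

(** phi is additive and equals the extension at z on each Taylor polynomial; the
    bound by the supremum over r B_X then makes phi commute with the sum of the
    Taylor series. *)
Lemma gelfand_fiber z (r : R) f phi : 0 < r -> poly_fiber z r phi ->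
  phi f = ext_entire f z.
Proof.
move=> r0 [sphi phiP phi_le].
pose Q := xget (fun _ _ => 0) [set Q | taylor_series f 0 Q].
have fQ : taylor_series f 0 Q by exact: (xgetPex _ ((Hb_setP f).1 0)).
have [M hM] := Hb_taylor_bound r0 (Hb_setP f) fQ.
have hQ : forall m, homog_poly m (Q m) by case: fQ.
pose QH m := to_Hb (Hb_set_homog (hQ m)).
suff Lphi : (fun n => \sum_(m < n) ext_homog m (Q m) z) @ \oo --> phi f.
  by rewrite /ext_entire -/Q; apply/esym; apply: cvg_lim Lphi; exact: norm_hausdorff.
apply: (@cvg_geometric_bound _ _ _ _ M) => n.
have hS : Hb_set (fun x => \sum_(m < n) Q m x).
  elim: n => [|n ih].
    under eq_fun do rewrite big_ord0; exact: Hb_set_homog (homog_poly0 X 0).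
  under eq_fun do rewrite big_ord_recr /= addrC -[Q n _]mul1r.
  by apply: Hb_set_comb ih; exact: Hb_set_homog.
have -> : \sum_(m < n) ext_homog m (Q m) z = phi (to_Hb hS).
  rewrite (spectrum_additive sphi (n := n) (Q := QH)); last first.
    by move=> x; rewrite to_HbE; apply: eq_bigr => m _; rewrite to_HbE.
  apply: eq_bigr => m _; have cQ := homog_cont_poly (hQ m).
  by rewrite phiP to_HbE// (ext_poly_homog z (hQ m) cQ).
have hD := Hb_set_comb (-1) hS (Hb_setP f).
have -> : phi f - phi (to_Hb hS) = phi (to_Hb hD).
  have [_ _ lphi _] := sphi; rewrite (lphi (-1) (to_Hb hS) f (to_Hb hD)).
    by rewrite mulN1r addrC.
  by move=> x; rewrite !to_HbE.
apply: le_trans (phi_le _) _; rewrite to_HbE; apply: supnorm_le => // x xr.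
by rewrite mulN1r addrC; exact: hM.
Qed.

(** The functional is the limit along a net of the ball converging to z, so it
    inherits the algebraic identities and the bound by the supremum; the bound
    gives continuity. *)
Lemma ext_entire_fiber z (r : R) : 0 < r -> rnorm z <= r ->
  poly_fiber z r (fun f => ext_entire f z).
Proof.
move=> r0 zr; have [N [Nr Nz]] := homog_net r0 zr; have FN := net_lim_proper N.
have lim g : g @ net_lim N --> ext_entire g z.
  apply: (cvg_ext_entire FN r0 Nz); exact: net_lim_all.
have lim_unique (l : Cplx R) g : g @ net_lim N --> l -> ext_entire g z = l.
  by move=> gl; exact: cvg_rnorm_unique (lim g) gl.
have lin (c : Cplx R) f g h : (forall x, h x = c * f x + g x) ->
    ext_entire h z = c * ext_entire f z + ext_entire g z.
  move=> hE; apply: lim_unique; rewrite (_ : Hb_fun h = fun x => c * f x + g x); last exact/funext.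
  by apply: cvgD (lim g); apply: cvgMr; exact: lim.
have bnd g : rnorm (ext_entire g z) <= supnorm (oball r) g.
  apply: (cvg_rnorm_le FN (lim g)); apply: net_lim_all => a; exact: le_supnorm.
split; last first.
- by move=> g; exact: bnd.
- by move=> P cP; apply: lim_unique; exact: cvg_cont_poly.
split=> //.
- exists (to_Hb (Hb_set_homog (homog_poly_cst X 1))).
  rewrite (lim_unique 1) ?oner_neq0// to_HbE; exact: cvg_cst.
- move=> g; have FG : Filter (nbhs g) by exact: nbhs_filter.
  apply: (iffRL (@cvg_rnormP R (Cplx R) (Hb X) (nbhs g) FG _ _)) => e e0.
  have e2 : 0 < e / 2 by rewrite divr_gt0.
  apply: filterS (nbhs_Hb_ball r g e2) => h gh.
  have hD := Hb_set_comb (-1) (Hb_setP h) (Hb_setP g).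
  have <- : ext_entire (to_Hb hD) z = ext_entire g z - ext_entire h z.
    rewrite (lin (-1) h g (to_Hb hD)); first by rewrite mulN1r addrC.
    by move=> x; rewrite to_HbE.
  apply: le_lt_trans (bnd _) _; apply: (@le_lt_trans _ _ (e / 2)); last lra.
  apply: supnorm_le => // x xr; rewrite to_HbE mulN1r addrC; exact/ltW/gh.
- move=> f g h hE; apply: lim_unique.
  rewrite (_ : Hb_fun h = fun x => f x * g x); last exact/funext.
  by apply: cvgM; exact: lim.
Qed.

Lemma cluster_set_eq (r : R) f z : 0 < r -> rnorm z <= r ->
  cluster_set r f z = [set ext_entire f z].
Proof.
move=> r0 zr; apply/seteqP; split=> [l [N [Nr Nz Nl]]|_ ->].
  have FN := net_lim_proper N.
  have Nz' : converges_to z (net_lim N) by apply/converges_toP.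
  apply: (cvg_rnorm_unique Nl); apply: (cvg_ext_entire FN r0 Nz').
  by apply: net_lim_all => a; rewrite -oballE; exact: Nr.
have [N [Nr Nz]] := homog_net r0 zr; have FN := net_lim_proper N.
exists N; split; first by move=> a; rewrite oballE.
- exact/converges_toP.
- by apply: (cvg_ext_entire FN r0 Nz); exact: net_lim_all.
Qed.

Lemma gelfand_fiber_eq (r : R) f z : 0 < r -> rnorm z <= r ->
  gelfand f @` poly_fiber z r = [set ext_entire f z].
Proof.
move=> r0 zr; apply/seteqP; split=> [_ [phi hphi <-]|_ ->].
  exact: gelfand_fiber hphi.
by exists (fun g => ext_entire g z) => //; exact: ext_entire_fiber.
Qed.

End ClusterValue.

Theorem mainTheorem4 (R : realType) (X : completeNormedModType R[i])
  (r : R) (f : Hb X) (z : dual (dual X)) :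
  0 < r -> `|z| <= r%:C ->
  [/\ cluster_set r f z = gelfand f @` poly_fiber z r,
      cluster_set r f z = [set ext_entire f z]
    & gelfand f @` poly_fiber z r = [set ext_entire f z]].
Proof.
rewrite rnormE lecR => r0 zr.
by split; rewrite ?cluster_set_eq ?gelfand_fiber_eq.
Qed.
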